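(* There exists a platypus snark (that is, a snark which is a platypus) of order $n$ if and only if $n = 10$ or $n$ is even and $n \ge 18$.
   Context: Graphs are finite and simple, with at least three vertices. A graph is hamiltonian (traceable) if it contains a spanning cycle (spanning path). A platypus is a non-hamiltonian graph $G$ such that for every vertex $v$ of $G$ the vertex-deleted subgraph $G-v$ is traceable. A snark is a cubic (i.e. $3$-regular) cyclically $4$-edge-connected graph with chromatic index $4$ (i.e. four colours are required in any proper edge-colouring) and girth at least $5$. A connected graph is cyclically $4$-edge-connected if deleting fewer than $4$ edges never leaves a graph with two components each containing a cycle. The order of a graph is its number of vertices. *)

(* Defs.v *)
From mathcomp Require Export all_boot.

Set Implicit Arguments.
Unset Strict Implicit.
Unset Printing Implicit Defensive.

Record sgraph := SGraph {
  vertex :> finType;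
  adj : rel vertex;
  adj_sym : symmetric adj;
  adj_irrefl : irreflexive adj }.

Definition graph_order (G : sgraph) : nat := #|G|.

(* An edge is the two-element set of its ends. *)
Definition edges (G : sgraph) : {set {set G}} :=
  [set [set x; y] | x in G, y in G & adj x y].

Section Deletion.
Variable G : sgraph.

Section Vertex.
Variable v : G.
Definition vdel_rel : rel {x : G | x != v} := fun x y => adj (val x) (val y).
Lemma vdel_sym : symmetric vdel_rel.
Proof. by move=> x y; apply: adj_sym. Qed.
Lemma vdel_irrefl : irreflexive vdel_rel.
Proof. by move=> x; apply: adj_irrefl. Qed.
Definition vdel : sgraph := SGraph vdel_sym vdel_irrefl.
End Vertex.

Section Edges.
Variable F : {set {set G}}.
Definition edel_rel : rel G := fun x y => adj x y && ([set x; y] \notin F).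
Lemma edel_sym : symmetric edel_rel.
Proof. by move=> x y; rewrite /edel_rel adj_sym setUC. Qed.
Lemma edel_irrefl : irreflexive edel_rel.
Proof. by move=> x; rewrite /edel_rel adj_irrefl. Qed.
Definition edel : sgraph := SGraph edel_sym edel_irrefl.
End Edges.

End Deletion.

(* A cycle is listed without repeating its first vertex, so that its length is
   [size c]. The bound excludes the degenerate cycles that [path.cycle]
   accepts, such as a single edge traversed back and forth. *)
Definition is_cycle (G : sgraph) (c : seq G) : bool :=
  [&& 3 <= size c, cycle (@adj G) c & uniq c].

Definition hamiltonian (G : sgraph) : Prop :=
  exists c : seq G, is_cycle c /\ (forall x : G, x \in c).

Definition traceable (G : sgraph) : Prop :=
  exists (x : G) (p : seq G),
    [/\ path (@adj G) x p, uniq (x :: p) & forall y : G, y \in x :: p].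

Definition platypus (G : sgraph) : Prop :=
  [/\ 3 <= graph_order G, ~ hamiltonian G & forall v : G, traceable (vdel v)].

Definition cubic (G : sgraph) : Prop :=
  forall x : G, #|[set y | adj x y]| = 3.

Definition connected (G : sgraph) : Prop :=
  forall x y : G, connect (@adj G) x y.

Definition component (G : sgraph) (x : G) : {set G} :=
  [set y | connect (@adj G) x y].

Definition contains_cycle (G : sgraph) (A : {set G}) : Prop :=
  exists c : seq G, is_cycle c /\ {subset c <= A}.

Definition cyclically_edge_connected (k : nat) (G : sgraph) : Prop :=
  connected G /\
  forall F : {set {set G}}, F \subset edges G -> #|F| < k ->
    ~ exists x y : edel F,
        [/\ component x != component y,
            contains_cycle (component x) & contains_cycle (component y)].

Definition girth_at_least (g : nat) (G : sgraph) : Prop :=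
  forall c : seq G, is_cycle c -> g <= size c.

Section ChromaticIndex.
Variable G : sgraph.

Definition edge : finType := {A : {set G} | A \in edges G}.

Definition proper_edge_coloring (k : nat) (c : {ffun edge -> 'I_k}) : bool :=
  [forall A : edge, forall B : edge,
    (A != B) && (val A :&: val B != set0) ==> (c A != c B)].

Definition edge_colorable (k : nat) : bool :=
  [exists c : {ffun edge -> 'I_k}, proper_edge_coloring c].

Lemma edge_colorable_ex : exists k, edge_colorable k.
Proof.
exists #|{: edge}|; apply/existsP; exists [ffun A => enum_rank A].
apply/forallP=> A; apply/forallP=> B; apply/implyP=> /andP[AB _].
by rewrite !ffunE (inj_eq enum_rank_inj).
Qed.

Definition chromatic_index : nat := ex_minn edge_colorable_ex.

End ChromaticIndex.

Definition snark (G : sgraph) : Prop :=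
  [/\ 3 <= graph_order G /\ cubic G, cyclically_edge_connected 4 G,
      chromatic_index G = 4 & girth_at_least 5 G].

(* Main.v *)
(** A hamiltonian cubic graph is 3-edge-colourable, since its order is even; so the members of
    the families below are non-hamiltonian once they are known not to be 3-edge-colourable.

    Existence.  Let ab and cd be disjoint edges of G, and let Q be the Petersen graph minus two
    adjacent vertices x and y.  Delete ab and cd, join a and b to the two former neighbours of x
    in Q, and c and d to those of y.  As the Petersen graph is not 3-edge-colourable, in every
    3-edge-colouring of Q with its four dangling edges the two edges that pointed to x have the
    same colour, and so have the two that pointed to y; hence a 3-edge-colouring of the new graph
    induces one of G.  A spanning path of G - v which uses ab or cd can be rerouted through Q.
    With a few more prescribed spanning paths of G, this makes the whole set of requirements
    hereditary, for the new marked edges between a, c and Q: each good order n yields n + 8, and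
    orders 10, 20, 22 and 24 are checked by computation.

    Nonexistence.  The order of a cubic graph is even, and an exhaustive search shows that all
    connected cubic graphs of girth at least 5 and order at most 8, 12, 14 or 16 are
    hamiltonian. *)

Require Import Defs.
From mathcomp Require Import zify.

Set Implicit Arguments.
Unset Strict Implicit.
Unset Printing Implicit Defensive.

(** * Reflective search for small cubic graphs *)

(* [has] and [all] are built on [||] and [&&], which [vm_compute] evaluates eagerly on both
   sides; a backtracking search needs these versions. *)
Fixpoint any (T : Type) (p : T -> bool) (s : seq T) : bool :=
  if s is x :: s' then (if p x then true else any p s') else false.

Fixpoint every (T : Type) (p : T -> bool) (s : seq T) : bool :=
  if s is x :: s' then (if p x then every p s' else false) else true.

Definition occurs (x : nat) := any (eqn x).

Definition deficient (r : seq nat) := if r is [:: _, _, _ & _] then false else true.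

Definition row (s : seq (seq nat)) x := nth [::] s x.

(** The parameter [p] is the vertex just left, so only walks without an immediate return are
    followed; the initial choice [p = x] forbids nothing in a loopless graph. *)
Fixpoint ball s d p x : seq nat :=
  if d is d'.+1 then
    flatten [seq (if eqn w p then [::] else w :: ball s d' x w) | w <- row s x]
  else [::].

(* [x :: p] is the walk made so far, in reverse. *)
Section Walk.
Variables (s : seq (seq nat)) (ok : rel nat) (fin : nat -> seq nat -> bool).

Fixpoint walk d x p : bool :=
  if d is d'.+1 then
    any (fun w => if occurs w (x :: p) then false
                  else if ok x w then walk d' w (x :: p) else false) (row s x)
  else fin x p.

End Walk.

Definition ham_search s n :=
  walk s (fun _ _ => true) (fun x _ => occurs 0 (row s x)) n.-1 0 [::].

(** For [y = size s] the outer [set_nth] lengthens the list: this is how a new vertex gets its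
    name. *)
Definition add_edge (s : seq (seq nat)) x y :=
  set_nth [::] (set_nth [::] s x (y :: row s x)) y (x :: row s y).

(* [s] lists the known neighbours of the vertices named so far, 0 to [k - 1].  The first vertex
   [x] with a missing neighbour is joined to a named vertex, at distance more than [d] so that no
   cycle of length at most [d + 1] arises, or to the new vertex [k].  The missing neighbours of
   [x] are added in increasing order, which is what the lower bound [lb] is for.  If no neighbour
   is missing and [k < n], the graph is disconnected. *)
Fixpoint search n d fuel s lb : bool :=
  if fuel is fuel'.+1 then
    let k := size s in
    let x := find deficient s in
    if eqn x k then (if k < n then true else ham_search s n)
    else
      let b := ball s d x x in
      let go y := let s' := add_edge s x y in
                  search n d fuel' s' (if deficient (row s' x) then y.+1 else 0) in
      if every (fun y => if deficient (row s y) then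
                           if occurs y b then true else if eqn y x then true else go y
                         else true) (iota lb (k - lb))
      then (if k < n then go k else true) else false
  else false.

Definition five_cycle := [:: [:: 1; 4]; [:: 0; 2]; [:: 1; 3]; [:: 2; 4]; [:: 3; 0]].

Lemma anyE (T : Type) (p : T -> bool) s : any p s = has p s.
Proof. by elim: s => //= x s ->; case: (p x). Qed.

Lemma everyE (T : Type) (p : T -> bool) s : every p s = all p s.
Proof. by elim: s => //= x s ->; case: (p x). Qed.

Lemma occursE x s : occurs x s = (x \in s).
Proof. by rewrite /occurs anyE -has_pred1; apply: eq_has => y; rewrite /= eq_sym. Qed.

Lemma deficientE r : deficient r = (size r < 3).
Proof. by case: r => [|? [|? [|? ?]]]. Qed.

Lemma row_add_edge s x y z :
  row (add_edge s x y) z =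
  if z == y then x :: row s y else if z == x then y :: row s x else row s z.
Proof. by rewrite /row /add_edge !nth_set_nth /=; case: eqP => // _; rewrite nth_set_nth. Qed.

Lemma size_add_edge s x y :
  x < size s -> y <= size s -> size (add_edge s x y) = maxn y.+1 (size s).
Proof. by move=> xs ys; rewrite !size_set_nth (maxn_idPr xs). Qed.

Lemma mem_row s x y : y \in row s x -> x < size s.
Proof. by rewrite /row; case: ltnP => // sx; rewrite nth_default. Qed.

Lemma ball_path s d p x y :
  y \in ball s d p x ->
  exists q, [/\ path (fun i j => j \in row s i) x q, last x q = y & size q <= d].
Proof.
elim: d p x => //= d IH p x /flatten_mapP[w xw].
case: eqn => //; rewrite inE => /orP[/eqP->|/IH[q [wq <- sq]]].
  by exists [:: w]; rewrite /= xw.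
by exists (w :: q); rewrite /= xw wq.
Qed.

(** The walk is accumulated in reverse, hence the transposed relation [e]. *)
Lemma walkP s ok fin d x p :
  let e i j := (i \in row s j) && ok j i in
  walk s ok fin d x p -> uniq (x :: p) -> path e x p ->
  exists y q, [/\ fin y q, uniq (y :: q), path e y q,
    last y q = last x p & size q = d + size p].
Proof.
move=> e; elim: d x p => [|d IH] x p; first by exists x, p.
rewrite [walk _ _ _ _ _ _]/= anyE => /hasP[w xw]; rewrite occursE.
case: ifPn => // wxp; case: ifP => // okxw /IH h uxp exp.
have [||y [q [? ? ? lq sq]]] := h; first by rewrite cons_uniq wxp.
  by rewrite /= /e xw okxw.
by exists y, q; rewrite lq sq addnS.
Qed.

(** * Partial graphs embedded in a cubic graph, and soundness of the search *)

Section Search.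
Variables (G : sgraph) (d : nat).
Hypotheses (cubG : cubic G) (connG : connected G).
Hypotheses (girG : girth_at_least d.+2 G) (nhamG : ~ hamiltonian G).

(** The values of [f] from [size s] on are unconstrained, so a new vertex is named by changing [f]
    at one place. *)
Definition realizes (s : seq (seq nat)) (f : nat -> G) : Prop :=
  [/\ {in gtn (size s) &, injective f},
      forall x y, y \in row s x -> adj (f x) (f y),
      forall x y, y \in row s x -> x \in row s y &
      forall x, uniq (row s x)].

Lemma row_bound s f x y : realizes s f -> y \in row s x -> y < size s.
Proof. by move=> [_ _ symf _] /symf /mem_row. Qed.

Lemma uniq_row_map s f x : realizes s f -> uniq (map f (row s x)).
Proof.
move=> rsf; rewrite map_inj_in_uniq; first by case: rsf.
move=> i j /(row_bound rsf) i_s /(row_bound rsf) j_s.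
by case: rsf => injf _ _ _; apply: injf.
Qed.

Lemma row_map_sub s f x :
  realizes s f -> {subset map f (row s x) <= [set y | adj (f x) y]}.
Proof. by case=> _ adjf _ _ _ /mapP[y xy ->]; rewrite inE adjf. Qed.

Lemma full_row s f x w :
  realizes s f -> ~~ deficient (row s x) -> adj (f x) w -> w \in map f (row s x).
Proof.
rewrite deficientE -leqNgt => rsf sx xw.
have [||_ ->] := uniq_min_size (uniq_row_map x rsf) (s2 := enum [set y | adj (f x) y]).
- by move=> z /(row_map_sub rsf); rewrite mem_enum.
- by rewrite size_map -cardE cubG.
by rewrite mem_enum inE.
Qed.

Lemma deficient_row s f x :
  realizes s f -> deficient (row s x) ->
  exists2 w, adj (f x) w & w \notin map f (row s x).
Proof.
rewrite deficientE => rsf sx.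
have : ~~ ([set y | adj (f x) y] \subset map f (row s x)).
  apply/negP=> /subset_leq_card; rewrite cubG; apply/negP; rewrite -ltnNge.
  by rewrite (leq_ltn_trans (card_size _)) ?size_map.
by case/subsetPn=> w; rewrite inE; exists w.
Qed.

(** A path of length at most [d] from [x] to [y], closed by the missing edge, would be a cycle of
    length at most [d.+1]. Hence the search may discard the ball around [x]. *)
Lemma ball_adj s f p x y :
  realizes s f -> x < size s -> adj (f x) (f y) -> y \notin row s x ->
  y \notin ball s d p x.
Proof.
move=> rsf xs xy yx; apply/negP=> /ball_path[q0 [q0p q0y q0d]].
case: (shortenP q0p) q0y => q pq uq sq lq {q0p}.
have {sq q0d}qd := leq_trans (uniq_leq_size (subseq_uniq (subseq_cons q x) uq) sq) q0d.
have all_s : {in x :: q, forall z, z < size s}.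
  move=> z; rewrite inE => /predU1P[->//|]; elim: q x {xs xy yx uq lq qd} pq => //= w q IH x.
  by case/andP=> /(row_bound rsf) ws /IH h; rewrite inE => /predU1P[->|/h].
case: rsf => injf adjf _ _.
suff: is_cycle (map f (x :: q)) by move/girG; rewrite size_map /= ltnS ltnNge qd.
apply/and3P; split.
- rewrite size_map; case: q pq lq {uq qd all_s} => [|w [|//]] /=.
    by move=> _ E; rewrite -E adj_irrefl in xy.
  by move=> /andP[xw _] E; rewrite -E xw in yx.
- rewrite /= rcons_path last_map lq adj_sym xy andbT path_map.
  by apply: sub_path pq => i j; apply: adjf.
- by rewrite map_inj_in_uniq // => i j /all_s i_s /all_s j_s; apply: injf.
Qed.

Lemma realizes_add_edge s f x y :
  realizes s f -> x < size s -> y <= size s ->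
  {in gtn (maxn y.+1 (size s)) &, injective f} ->
  adj (f x) (f y) -> y \notin row s x -> realizes (add_edge s x y) f.
Proof.
move=> rsf xs ys inj' xy yx; have [_ adjf symf uniqf] := rsf.
have neq : x != y by apply: contraTneq xy => ->; rewrite adj_irrefl.
have xy' : x \notin row s y by apply: contra yx; apply: symf.
have lnk z w : w \in row (add_edge s x y) z =
    [|| (z == y) && (w == x), (z == x) && (w == y) | w \in row s z].
  rewrite row_add_edge; have [->|zy] := eqVneq z y; last by case: eqP => [->|_]; rewrite ?inE.
  by rewrite inE [y == x]eq_sym (negbTE neq).
split; rewrite ?size_add_edge // => z.
- move=> w; rewrite lnk => /or3P[/andP[/eqP-> /eqP->]|/andP[/eqP-> /eqP->]|/adjf//] //.
  by rewrite adj_sym.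
- move=> w; rewrite !lnk => /or3P[/andP[-> ->]|/andP[-> ->]|/symf->];
    by rewrite ?orbT.
- rewrite row_add_edge; case: (z == y); first by rewrite /= xy' uniqf.
  by case: (z == x); rewrite /= ?yx ?uniqf.
Qed.

Lemma realizes_ham s f : realizes s f -> 0 < size s -> ~ ham_search s #|G|.
Proof.
move=> rsf s0 /walkP[] // x [q [+ uq pq lq sq]]; rewrite occursE => x0.
have [injf adjf symf _] := rsf; apply: nhamG.
have all_s : {in x :: q, forall z, z < size s}.
  move=> z; rewrite inE => /predU1P[->|]; first by rewrite (mem_row x0).
  elim: q (x) pq {uq lq sq x0} => //= w q IH y /andP[/andP[/mem_row ws _] /IH h].
  by rewrite inE => /predU1P[->|/h].
have G0 : 0 < #|G| by apply/card_gt0P; exists (f 0).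
have ufq : uniq (map f (x :: q)).
  by rewrite map_inj_in_uniq // => i j /all_s i_s /all_s j_s; apply: injf.
have szq : size (map f (x :: q)) = #|G| by rewrite size_map /= sq addn0 prednK.
exists (map f (x :: q)); split.
  apply/and3P; split=> //.
    by rewrite szq (leq_trans _ (max_card [set y | adj (f 0) y])) ?cubG.
  rewrite /= rcons_path last_map lq adj_sym adjf // path_map andbT.
  by apply: sub_path pq => i j /andP[/symf/adjf].
move=> z; have [||_ ->] := uniq_min_size ufq (s2 := enum G).
- by move=> w; rewrite mem_enum.
- by rewrite szq -cardE.
- by rewrite mem_enum.
Qed.

(** Full rows make the image of [f] closed under adjacency, and connectivity makes it everything. *)
Lemma realizes_closed s f :
  realizes s f -> 0 < size s -> ~~ has deficient s -> #|G| <= size s.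
Proof.
move=> rsf s0 nd; have [injf _ symf _] := rsf.
have closed z : z \in map f (iota 0 (size s)) -> forall w, adj z w -> w \in map f (iota 0 (size
  s)).
  case/mapP=> i; rewrite mem_iota => /= i_s -> w zw.
  have : ~~ deficient (row s i) by apply: contra nd => di; apply/hasP; exists (row s i);
    rewrite ?mem_nth.
  move=> /(full_row rsf)/(_ zw)/mapP[j /symf/mem_row js ->].
  by rewrite map_f // mem_iota.
have all_f w : w \in map f (iota 0 (size s)).
  have /connectP[p fp ->] := connG (f 0) w.
  have : f 0 \in map f (iota 0 (size s)) by rewrite map_f ?mem_iota.
  by elim: p (f 0) fp => //= z p IH y /andP[yz zp] /closed /(_ _ yz); apply: IH.
rewrite -(size_iota 0 (size s)) -(size_map f) (leq_trans _ (card_size _)) //.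
by rewrite subset_leq_card //; apply/subsetP=> w _; apply: all_f.
Qed.

(** Rows before [x] are untouched. So the lower bound handed to the next call still refers to the
    same vertex [x]. *)
Lemma find_deficient_add_edge s x y :
  x = find deficient s -> x < y -> y <= size s -> deficient (row (add_edge s x y) x) ->
  find deficient (add_edge s x y) = x.
Proof.
move=> fx xy ys dx.
have xl : x < size (add_edge s x y) by rewrite size_add_edge ?leq_max ?ltnS ?(ltnW xy) //
  (leq_trans xy).
have hl : has deficient (add_edge s x y).
  by apply/hasP; exists (row (add_edge s x y) x); rewrite ?mem_nth.
apply/eqP; rewrite eqn_leq; apply/andP; split; rewrite leqNgt; apply/negP.
  by move=> /(before_find [::]); rewrite -/(row _ _) dx.
move=> lt_x; have := nth_find [::] hl; rewrite -/(row _ _) row_add_edge.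
rewrite (ltn_eqF lt_x) (ltn_eqF (ltn_trans lt_x xy)) => dz.
by move: lt_x; rewrite {2}fx => /(before_find [::]); rewrite -/(row _ _) dz.
Qed.

(** [G] itself singles out a branch of the search tree along which the partial graph stays embedded;
    success on that branch would exhibit a hamiltonian cycle. The hypothesis on [lb] says that the
    neighbours with names below [lb] are already recorded. *)
Lemma search_sound fuel s lb f :
  realizes s f -> 0 < size s ->
  (forall y, y < lb -> adj (f (find deficient s)) (f y) -> y \in row s (find deficient s)) ->
  ~ search #|G| d fuel s lb.
Proof.
elim: fuel s lb f => // fuel IH s lb f rsf s0 lbP /=.
set x := find deficient s in lbP *; set k := size s; have [injf adjf symf uniqf] := rsf.
case: eqnP => [xk|/eqP neq].
  have nd : ~~ has deficient s by rewrite has_find -/x xk ltnn.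
  by rewrite ltnNge (realizes_closed rsf) //; apply: realizes_ham rsf s0.
have hd : has deficient s by rewrite has_find ltn_neqAle neq find_size.
have xs : x < k by rewrite -has_find.
have dx : deficient (row s x) := nth_find [::] hd.
have step g y : realizes s g -> x < y -> y <= k -> adj (g x) (g y) -> y \notin row s x ->
    {in gtn (maxn y.+1 k) &, injective g} ->
    (forall z, z < y -> adj (g x) (g z) -> z \in row s x) ->
    ~ search #|G| d fuel (add_edge s x y) (if deficient (row (add_edge s x y) x) then y.+1 else
      0).
  move=> rsg xy yk gxy yx injg ltP; apply: (IH _ _ g); first exact: realizes_add_edge.
    by rewrite size_add_edge // leq_max.
  case: ifP => // dlx z; rewrite find_deficient_add_edge // ltnS row_add_edge eqxx (ltn_eqF xy)
    inE.
  by rewrite leq_eqVlt => /predU1P[->|/ltP h /h ->]; rewrite ?eqxx ?orbT.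
rewrite everyE; case: allP => // cand new.
have [w xw wx] := deficient_row rsf dx.
(* If some unrecorded neighbour of [x] has a name, the smallest one is joined, so that everything
   below the new lower bound is recorded; otherwise [w] receives the name [k]. *)
case: (boolP (has (fun y => adj (f x) (f y) && (y \notin row s x)) (iota 0 k))) => [|none].
  move=> /hasP[y0]; rewrite mem_iota => /= y0k y0P.
  have ex : exists y, (y < k) && (adj (f x) (f y) && (y \notin row s x)).
    by exists y0; rewrite y0k.
  case: (ex_minnP ex) => y /and3P[yk xy yx] ymin.
  have dy : deficient (row s y).
    have yx' : adj (f y) (f x) by rewrite adj_sym.
    apply: contraR yx => /(full_row rsf)/(_ yx')/mapP[z zy E].
    by rewrite (injf x z xs (row_bound rsf zy) E) symf.
  (* Every vertex before [x] is full, whereas [y] still lacks the neighbour [x]; hence [x < y]. *)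
  have yneq : y != x by apply: contraTneq xy => ->; rewrite adj_irrefl.
  have ltxy : x < y.
    rewrite ltn_neqAle eq_sym yneq leqNgt; apply/negP=> /(before_find [::]).
    by rewrite -/(row _ _) dy.
  have := cand y; rewrite mem_iota dy occursE (negbTE (ball_adj _ rsf xs xy yx)).
  rewrite (_ : eqn y x = (y == x)) // (negbTE yneq) => h.
  apply: (step f y rsf ltxy (ltnW yk) xy yx); last apply: h.
  - by rewrite (maxn_idPr yk).
  - move=> z zy xz; apply: contraLR zy => zx; rewrite -leqNgt.
    case: (ltnP z k) => [zk|/(leq_trans (ltnW yk))//].
    by apply: ymin; rewrite zk xz zx.
  have lby : lb <= y by rewrite leqNgt; apply: contra yx => /lbP; apply.
  by rewrite lby subnKC // (leq_trans lby (ltnW yk)).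
pose g i := if i == k then w else f i.
have gf i : i < k -> g i = f i by rewrite /g; case: eqP => // ->; rewrite ltnn.
have w_new i : i < k -> f i != w.
  move=> ik; apply: contra none => /eqP fi; apply/hasP; exists i; first by rewrite mem_iota.
  by rewrite fi xw; apply: contra wx => ix; rewrite -fi map_f.
have injg : {in gtn k.+1 &, injective g}.
  move=> i j; rewrite !inE !ltnS [i <= k]leq_eqVlt [j <= k]leq_eqVlt.
  move=> /predU1P[->|ik] /predU1P[->|jk] //; rewrite ?[g k]/g ?eqxx ?gf //.
  - by move=> E; move: (w_new _ jk); rewrite E eqxx.
  - by move/eqP; rewrite (negbTE (w_new _ ik)).
  - exact: injf.
have rsg : realizes s g.
  split=> // [i j ik jk|i j ij].
    by apply: injg; rewrite inE ltnW.
  by rewrite !gf ?adjf ?(mem_row ij) ?(row_bound rsf ij).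
(* The names 0 to [k] go to distinct vertices, so the guard on new vertices is passed. *)
have kG : k < #|G|.
  rewrite -(size_iota 0 k.+1) -(size_map g).
  have /card_uniqP <- : uniq (map g (iota 0 k.+1)).
    by rewrite map_inj_in_uniq ?iota_uniq // => i j; rewrite !mem_iota; apply: injg.
  exact: max_card.
rewrite kG in new; apply: (step g k rsg xs (leqnn k)) new.
- by rewrite gf // /g eqxx.
- by apply/negP=> /(row_bound rsf); rewrite ltnn.
- by rewrite (maxn_idPl (leqnSn k)).
move=> z zk; rewrite !gf // => xz; apply: contraR none => zx.
by apply/hasP; exists z; rewrite ?mem_iota // xz zx.
Qed.
End Search.

(** * Hamiltonicity of the small orders *)

Lemma is_cycle_girth (G : sgraph) d :
  girth_at_least d G -> (forall c : seq G, is_cycle c -> size c != d) ->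
  girth_at_least d.+1 G.
Proof. by move=> gd nd c cc; rewrite ltn_neqAle eq_sym nd ?gd. Qed.

Lemma realizes_vertex (G : sgraph) (x : G) : realizes [:: [::]] (fun=> x).
Proof.
split=> [[|i] [|j] //|[|[|i]] y|[|[|i]] y|[|[|i]]] //.
Qed.

Lemma realizes_five_cycle (G : sgraph) (c : seq G) (x : G) :
  is_cycle c -> size c = 5 -> realizes five_cycle (nth x c).
Proof.
case/and3P=> _ + /(uniqP x); case: c => [|a [|b [|c [|d [|e [|? ?]]]]]] // + u _.
rewrite /cycle /= andbT => /and5P[ab bc cd de ea]; split.
- by move=> i j ic jc; apply: u.
- move=> [|[|[|[|[|i]]]]] y; rewrite /row /= ?nth_nil ?inE // => /orP[]/eqP-> //=;
  by rewrite adj_sym.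
- by move=> [|[|[|[|[|i]]]]] y; rewrite /row /= ?nth_nil ?inE // => /orP[]/eqP->.
- by move=> [|[|[|[|[|i]]]]]; rewrite /row /= ?nth_nil.
Qed.

(** Handshake: the number of adjacent ordered pairs is three times the order, and twice the number
    of pairs taken in increasing rank. *)
Lemma order_even (G : sgraph) : cubic G -> ~~ odd #|G|.
Proof.
move=> cubG.
have : \sum_(x : G) \sum_(y : G) (adj x y : nat) = #|G| * 3.
  rewrite -sum_nat_const; apply: eq_big => // x _; rewrite -(cubG x) -sum1_card.
  by rewrite [RHS]big_mkcond /=; apply: eq_bigr => y _; rewrite inE; case: (adj x y).
have -> : \sum_(x : G) \sum_(y : G) (adj x y : nat) =
    (\sum_(x : G) \sum_(y : G) (adj x y && (enum_rank x < enum_rank y) : nat)).*2.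
  rewrite -addnn [X in _ = _ + X]exchange_big /= -big_split /=; apply: eq_bigr => x _.
  rewrite -big_split /=; apply: eq_bigr => y _; rewrite [adj y x]adj_sym.
  case: ltngtP => [||/val_inj/enum_rank_inj->]; rewrite ?andbT ?andbF ?addn0 ?adj_irrefl //.
by move/(congr1 odd); rewrite odd_double oddM andbT => <-.
Qed.

(* A graph of girth 5 is searched from a 5-cycle, the others from a single vertex: this is about
   eight times faster than searching everything from a vertex. *)
Definition small_orders := [:: 4; 6; 8; 12; 14; 16].

(** Each call adds an edge, and a cubic graph has 3n/2 of them, so [2 * n] is enough fuel. Depth 3
    excludes cycles shorter than 5, depth 4 those shorter than 6. *)
Lemma search_small :
  all (fun n => search n 3 (2 * n) five_cycle 0) small_orders &&
  all (fun n => search n 4 (2 * n) [:: [::]] 0) small_orders.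
Proof. by vm_compute. Qed.

Lemma small_hamiltonian (G : sgraph) :
  cubic G -> connected G -> girth_at_least 5 G -> #|G| \in small_orders ->
  ~ ~ hamiltonian G.
Proof.
move=> cubG connG g5 small nhamG; have /andP[/allP s3 /allP s4] := search_small.
have G0 : 0 < #|G| by case: #|G| small.
have [x _] := card_gt0P G0.
(* A 5-cycle would be a starting point for the first search; without one, the second search starts
   from any vertex. *)
have g6 : girth_at_least 6 G.
  apply: (is_cycle_girth g5) => c cc; apply/negP=> /eqP c5.
  exact: (search_sound cubG connG g5 nhamG (realizes_five_cycle x cc c5) _ _ (s3 _ small)).
exact: (search_sound cubG connG g6 nhamG (realizes_vertex x) _ _ (s4 _ small)).
Qed.

(** * Edge cuts and edge colourings *)

Lemma cycle_card (G : sgraph) (A : {set G}) : contains_cycle A -> 1 < #|A|.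
Proof.
case=> c [/and3P[c3 _ uc] cA]; apply: leq_trans (ltnW c3) _.
by rewrite -(card_uniqP uc) subset_leq_card //; apply/subsetP.
Qed.

Section Generic.
Variable G : sgraph.

Lemma cubic_sum (x : G) : #|[set y | adj x y]| = \sum_(y : G) adj x y.
Proof.
rewrite -sum1_card [LHS]big_mkcond /=; apply: eq_bigr => y _.
by rewrite inE; case: (adj x y).
Qed.

(** Each cut edge counts once, from its end inside [S]. *)
Definition boundary (S : {set G}) : nat :=
  \sum_(x : G) \sum_(y : G) [&& adj x y, x \in S & y \notin S].

Lemma boundaryC (S : {set G}) : boundary (~: S) = boundary S.
Proof.
rewrite /boundary exchange_big; apply: eq_bigr => x _; apply: eq_bigr => y _.
by rewrite !inE negbK adj_sym [(x \in S) && _]andbC.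
Qed.

Lemma boundary1 (x : G) : cubic G -> boundary [set x] = 3.
Proof.
move=> cubG; rewrite -(cubG x) cubic_sum /boundary (bigD1 x) //= [X in _ + X]big1 => [|z zx].
  rewrite addn0; apply: eq_bigr => y _; rewrite !inE eqxx /=.
  by case: eqP => [->|]; rewrite ?adj_irrefl ?andbT.
by apply: big1 => y _; rewrite !inE (negbTE zx) andbF.
Qed.

(* For cubic graphs of girth at least 5 this is equivalent to cyclic 4-edge-connectivity, but it
   is a mere count. *)
Definition essentially_4_edge_connected : Prop :=
  forall S : {set G}, 1 < #|S| -> 1 < #|~: S| -> 3 < boundary S.

(** Colouring ordered pairs, constrained on adjacent ones only, makes colourings easy to restrict
    and to glue. *)
Definition k_colorable (k : nat) : Prop :=
  exists2 c : G -> G -> nat,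
    (forall x y, adj x y -> c x y = c y x /\ c x y < k) &
    (forall x y z, adj x y -> adj x z -> y != z -> c x y != c x z).

Hypothesis cubG : cubic G.

Lemma cubic_order : 3 < #|G| \/ #|G| = 0.
Proof.
case: (posnP #|G|) => [|/card_gt0P[x _]]; [by right | left].
have : [set y | adj x y] \proper predT.
  by apply/properP; split; [apply/subsetP | exists x; rewrite ?inE ?adj_irrefl].
by move/proper_card; rewrite cubG.
Qed.

(** A component has boundary 0. This is impossible both for a side with a single vertex, whose
    boundary is 3, and for two larger sides. *)
Lemma essentially_4_connected : essentially_4_edge_connected -> connected G.
Proof.
move=> e4c x y; pose S := component x.
have S0 : boundary S = 0.
  apply: big1 => u _; apply: big1 => v _; rewrite !inE.
  case: (boolP (adj u v)) => //= uv; case: (boolP (connect _ x u)) => //= xu.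
  by rewrite (connect_trans xu (connect1 uv)).
apply: contraLR isT => xy.
have xS : x \in S by rewrite inE connect0.
have yS : y \in ~: S by rewrite !inE.
have [S1|] := leqP #|S| 1; last move=> S1.
  suff E : S = [set x] by rewrite E boundary1 in S0.
  by apply/esym/eqP; rewrite eqEcard sub1set xS cards1.
have [S2|] := leqP #|~: S| 1; last by move=> S2; have := e4c S S1 S2; rewrite S0.
suff E : ~: S = [set y] by rewrite -boundaryC E boundary1 in S0.
by apply/esym/eqP; rewrite eqEcard sub1set yS cards1.
Qed.

Lemma boundary_card (S : {set G}) :
  boundary S = #|[set p : G * G | [&& adj p.1 p.2, p.1 \in S & p.2 \notin S]]|.
Proof.
rewrite /boundary pair_bigA -sum1_card [RHS]big_mkcond /=.
by apply: eq_bigr => p _; rewrite inE; case: [&& _, _ & _].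
Qed.

(** All edges leaving a component [S] of the graph without [F] lie in [F], so its boundary is at
    most 3, while a cycle on each side gives both sides two vertices. *)
Lemma essentially_4_cyclically_4 : essentially_4_edge_connected -> cyclically_edge_connected 4 G.
Proof.
move=> e4c; split; first exact: essentially_4_connected.
move=> F FE F4 [x [y [xy cx cy]]].
pose S : {set G} := component x.
have S1 : 1 < #|S| := cycle_card cx.
have S2 : 1 < #|~: S|.
  apply: leq_trans (cycle_card cy) (subset_leq_card _); apply/subsetP=> z.
  rewrite !inE => yz; apply: contra xy => xz; apply/eqP/setP=> w; rewrite !inE.
  have symF := sym_connect_sym (edel_sym F).
  by rewrite (same_connect symF xz) (same_connect symF yz).
have := e4c S S1 S2; rewrite ltnNge => /negP; apply.
rewrite -ltnS (leq_trans _ F4) // ltnS boundary_card.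
(* A pair leaving [S] is determined by its edge, as only one end is in [S]. *)
pose h (p : G * G) := [set p.1; p.2].
rewrite -(card_in_imset (f := h)) => [|[u v] [u' v']].
  apply: subset_leq_card; apply/subsetP=> _ /imsetP[[u v] + ->].
  rewrite !inE /= => /and3P[uv xu]; apply: contraR => uvF.
  by apply: connect_trans xu (connect1 _); rewrite /= /edel_rel uv.
rewrite !inE /= => /and3P[_ uS vS] /and3P[_ u'S v'S] /setP E.
have := E u; have := E v; rewrite !inE !eqxx ?orbT /=.
have n1 : (u == v') = false by apply: contraNF v'S => /eqP<-.
have n2 : (v == u') = false by apply: contraNF vS => /eqP->.
by rewrite n1 n2 orbF => /esym/eqP-> /esym/eqP->.
Qed.
End Generic.

(** * Edge colourings on pairs of vertices and the chromatic index *)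

Section Coloring.
Variable G : sgraph.

Lemma edge_in (x y : G) : adj x y -> [set x; y] \in edges G.
Proof. by move=> xy; apply/imset2P; exists x y; rewrite ?inE. Qed.

Definition mkedge (x y : G) (xy : adj x y) : edge G :=
  exist (fun A => A \in edges G) [set x; y] (edge_in xy).

Lemma set2_inj (T : finType) (x y u v : T) :
  [set x; y] = [set u; v] -> x = u /\ y = v \/ x = v /\ y = u.
Proof.
move=> E; have /set2P xE : x \in [set u; v] by rewrite -E set21.
have /set2P yE : y \in [set u; v] by rewrite -E set22.
have /set2P uE : u \in [set x; y] by rewrite E set21.
have /set2P vE : v \in [set x; y] by rewrite E set22.
by intuition congruence.
Qed.

Lemma edge_colorable_k k : edge_colorable G k -> k_colorable G k.
Proof.
case/existsP=> f /forallP fP.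
pose c (x y : G) : nat := if insub [set x; y] is Some e then f e else 0.
have cE x y (xy : adj x y) : c x y = f (mkedge xy).
  rewrite /c; case: insubP => [e _ eE|]; last by rewrite edge_in.
  by congr (nat_of_ord (f _)); apply: val_inj; rewrite eE.
exists c => [x y xy|x y z xy xz yz].
  by rewrite {1}/c setUC -/(c y x) (cE _ _ xy).
rewrite (cE _ _ xy) (cE _ _ xz); apply: contraNneq yz => /val_inj E.
have /forallP/(_ (mkedge xz)) := fP (mkedge xy).
rewrite E eqxx /= implybF negb_and !negbK => /orP[/eqP/(congr1 val)/set2_inj[[_ ->]//|[xz'
  yx]]|/eqP/setP/(_ x)].
  by rewrite yx -xz'.
by rewrite /= !inE !eqxx.
Qed.

Lemma k_edge_colorable k : k_colorable G k -> edge_colorable G k.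
Proof.
(* Without colours there is no edge; otherwise colour 0 can serve as a default value. *)
case=> c cS cP; case: k cS => [|k] cS.
  apply/existsP.
  have no_edge (A : edge G) : False.
    by case: A => A /imset2P[x y _]; rewrite inE => /cS[_].
  by exists [ffun A => False_rect _ (no_edge A)]; apply/forallP=> A; case: (no_edge A).
(* An arbitrary orientation of the edge is picked; the symmetry of [c] makes the choice harmless. *)
pose col (A : {set G}) := if [pick p : G * G | adj p.1 p.2 && (A == [set p.1; p.2])] is Some p
  then c p.1 p.2 else 0.
have colE x y : adj x y -> col [set x; y] = c x y.
  move=> xy; rewrite /col; case: pickP => [[u v] /= /andP[uv /eqP E]|/(_ (x, y))];
    last by rewrite /= xy eqxx.
  by case: (set2_inj E) => -[-> ->] //; rewrite (cS _ _ uv).1.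
have col_lt A : col A < k.+1.
  by rewrite /col; case: pickP => // p /andP[/cS[]].
apply/existsP; exists [ffun A : edge G => Ordinal (col_lt (val A))].
apply/forallP=> -[A eA]; apply/forallP=> -[B eB]; apply/implyP=> /andP[] /=.
rewrite !ffunE /= => AB /set0Pn[x]; rewrite inE => /andP[].
have mem_edge D : D \in edges G -> x \in D -> exists2 y, adj x y & D = [set x; y].
  case/imset2P=> u v _; rewrite inE => /andP[_ uv] ->; rewrite !inE => /orP[]/eqP->.
    by exists v.
  by exists u; rewrite 1?adj_sym // setUC.
case/(mem_edge _ eA)=> y xy EA; case/(mem_edge _ eB)=> z xz EB.
suff : col A != col B by apply: contraNneq => -[->].
rewrite EA EB !colE ?cP //; apply: contraNneq AB => yz.
by rewrite -val_eqE /= EA EB yz.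
Qed.

Lemma chromatic_index4 : k_colorable G 4 -> ~ k_colorable G 3 -> chromatic_index G = 4.
Proof.
move=> c4 nc3; rewrite /chromatic_index; case: ex_minnP => m cm minm.
apply/eqP; rewrite eqn_leq minm ?k_edge_colorable //= leqNgt; apply/negP=> m3.
case: nc3; have [c cS cP] := edge_colorable_k cm; exists c => // x y /cS[-> h].
by split=> //; apply: leq_trans h _.
Qed.

End Coloring.

Lemma index_next (T : eqType) (c : seq T) x :
  uniq c -> x \in c -> index (next c x) c = (index x c).+1 %% size c.
Proof.
move=> uc xc; rewrite next_nth xc; case: c uc xc => [//|y p] uc xc.
have : index x (y :: p) <= size p by move: xc; rewrite -index_mem.
rewrite leq_eqVlt => /predU1P[->|lt_i].
  by rewrite nth_default //= eqxx modnn.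
rewrite modn_small // -[nth y p _]/(nth y (y :: p) (index x (y :: p)).+1).
by rewrite index_uniq.
Qed.

(** The edges of the cycle alternate between colours 0 and 1, and the remaining perfect matching
    gets colour 2. *)
Lemma hamiltonian_3_colorable (G : sgraph) : cubic G -> hamiltonian G -> k_colorable G 3.
Proof.
move=> cubG [c [/and3P[c3 cc uc] allc]].
have szc : size c = #|G|.
  by rewrite -(card_uniqP uc); apply: eq_card => x; rewrite allc.
(* The parity also flips where the index wraps round to 0, because the order is even. *)
have odd_next x : odd (index (next c x) c) = ~~ odd (index x c).
  rewrite index_next // -[RHS]/(odd (index x c).+1).
  by rewrite [in RHS](divn_eq (index x c).+1 (size c)) oddD oddM szc (negbTE (order_even cubG))
    andbF.
have next2 x : next c (next c x) != x.
  apply/eqP=> /(congr1 (index^~ c)); rewrite index_next // index_next // -addn1 modnDml addn1.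
  have : index x c < size c by rewrite index_mem.
  move: (index x c) (size c) c3 => i n n3; rewrite leq_eqVlt => /predU1P[E|].
    by subst n; rewrite -addn1 modnDl modn_small ?(ltnW n3) // => E; rewrite -E in n3.
  rewrite leq_eqVlt => /predU1P[E|lt]; first by subst n; rewrite modnn => E; rewrite -E in n3.
  by rewrite modn_small // => /eqP; rewrite -addn2 -[X in _ == X]addn0 eqn_add2l.
have nextP x y : (next c y == x) = (y == prev c x).
  by apply/eqP/eqP=> [<-|->]; rewrite ?prev_next ?next_prev.
pose f x y : nat := if next c x == y then nat_of_bool (odd (index x c))
  else if next c y == x then nat_of_bool (odd (index y c)) else 2.
have adj_next x : adj x (next c x) by apply: next_cycle; rewrite ?allc.
have fS x y : f x y = f y x.
  rewrite /f; have [E|] := eqVneq (next c x) y; last by [].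
  by rewrite -E (negbTE (next2 x)).
exists f => [x y xy|x y z xy xz yz].
  split; first exact: fS.
  have lt3 (b : bool) : b < 3 by case: b.
  by rewrite /f; case: (next c x == y) => //; case: (next c y == x).
have {}fE w : f x w = if w == next c x then nat_of_bool (odd (index x c))
    else if w == prev c x then nat_of_bool (~~ odd (index x c)) else 2.
  rewrite /f [next c x == w]eq_sym [next c w == x]nextP; case: ifP => // _; case: eqP => // ->.
  by rewrite -[x in RHS](next_prev uc) odd_next negbK.
have np : next c x != prev c x by rewrite -nextP next2.
rewrite !fE; case: (eqVneq y (next c x)) => [yn|yn]; case: (eqVneq z (next c x)) => [zn|zn].
- by rewrite yn zn eqxx in yz.
- by case: (z == prev c x); case: odd.
- by case: (y == prev c x); case: odd.
case: (eqVneq y (prev c x)) => [yp|yp]; case: (eqVneq z (prev c x)) => [zp|zp].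
- by rewrite yp zp eqxx in yz.
- by case: odd.
- by case: odd.
have adj_prev : adj x (prev c x) by rewrite adj_sym -{2}(next_prev uc x) adj_next.
(* Two different edges of colour 2 at [x] would give it four neighbours. *)
have u4 : uniq [:: next c x; prev c x; y; z].
  by rewrite /= !inE !negb_or np yz ![_ == y]eq_sym ![_ == z]eq_sym yn yp zn zp.
have : {subset [:: next c x; prev c x; y; z] <= enum [set w | adj x w]}.
  by apply/allP; rewrite /= !mem_enum !inE adj_next adj_prev xy xz.
by move/(uniq_leq_size u4); rewrite -cardE cubG.
Qed.

Lemma girth5 (G : sgraph) :
  (forall x y z : G, adj x y -> adj y z -> ~~ adj z x) ->
  (forall x y z w : G, adj x y -> adj y z -> adj z w -> adj w x -> x != z -> y = w) ->
  girth_at_least 5 G.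
Proof.
move=> C3 C4 [|x [|y [|z [|w [|? ?]]]]] // /and3P[_ /=].
  by rewrite andbT => /and3P[xy yz]; rewrite (negbTE (C3 _ _ _ xy yz)).
rewrite andbT => /and4P[xy yz zw wx] /and4P[]; rewrite !inE !negb_or.
by move=> /and3P[_ xz _] /andP[_ /eqP yw] _; case: yw; apply: C4 xy yz zw wx xz.
Qed.

(** The count says at once that the path is simple, misses [v] and covers the rest, so spanning
    paths of [G - v] can be handled inside [G]. *)
Lemma traceable_vdel (G : sgraph) (v x : G) (p : seq G) :
  path (@adj G) x p -> (forall y, count_mem y (x :: p) = (y != v)) -> traceable (vdel v).
Proof.
move=> xp cnt.
have [[|x' p'] // [Ex Ep]] : exists q : seq (vdel v), map val q = x :: p.
  have : {in x :: p, forall y, y != v}.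
    by move=> y; rewrite -has_pred1 has_count cnt lt0b.
  elim: (x :: p) => [_|z s IH zs]; first by exists [::].
  have [|q <-] := IH; first by move=> y ys; apply: zs; rewrite inE ys orbT.
  by exists (exist (fun y => y != v) z (zs z (mem_head _ _)) :: q).
have cnt' y : count_mem y (x' :: p') = 1.
  have := cnt (val y); rewrite (valP y) => E.
  by rewrite -[RHS]E -Ex -Ep -/(map val (x' :: p')) count_map; apply: eq_count => z /=;
    rewrite -val_eqE.
exists x', p'; split.
- by rewrite -Ex -Ep path_map in xp.
- by apply: count_mem_uniq => y; rewrite cnt' -has_pred1 has_count cnt'.
- by move=> y; rewrite -has_pred1 has_count cnt'.
Qed.

(** * Inserting a block of the Petersen graph *)

Fixpoint uses (T : eqType) (x y u : T) (s : seq T) : nat :=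
  if s is v :: s' then
    ((u == x) && (v == y) || (u == y) && (v == x)) + uses x y v s'
  else 0.

Definition spanning_path (G : sgraph) (a b c d x y : G) : Prop :=
  exists s, [/\ path (@adj G) x s, last x s = y, forall z, count_mem z (x :: s) = 1,
    uses a b x s = 0 & uses c d x s = 0].

(** The invariant of the induction. [ext_vdel] asks for paths through a marked edge, where the block
    can be inserted; [ext_ad] and [ext_bc] avoid both marked edges and serve when the deleted vertex
    lies in the block. *)
Record extendable (G : sgraph) (a b c d : G) : Prop := Extendable {
  ext_cubic : cubic G;
  ext_uniq : uniq [:: a; b; c; d];
  ext_ab : adj a b;
  ext_cd : adj c d;
  ext_C3 : forall x y z : G, adj x y -> adj y z -> ~~ adj z x;
  ext_C4 : forall x y z w : G,
    adj x y -> adj y z -> adj z w -> adj w x -> x != z -> y = w;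
  ext_e4c : essentially_4_edge_connected G;
  ext_n3 : ~ k_colorable G 3;
  ext_4 : k_colorable G 4;
  ext_vdel : forall v, exists u s, [/\ path (@adj G) u s,
    forall y, count_mem y (u :: s) = (y != v) & 0 < uses a b u s + uses c d u s];
  ext_ad : spanning_path a b c d a d;
  ext_bc : spanning_path a b c d b c }.

Lemma extendable_snark (G : sgraph) (a b c d : G) : extendable a b c d -> snark G.
Proof.
move=> E; split.
- split; last exact: ext_cubic E.
  case: (cubic_order (ext_cubic E)) => [/ltnW//|]; last move=> G0.
  have : 0 < #|G| by apply/card_gt0P; exists a.
  by rewrite G0.
- exact: essentially_4_cyclically_4 (ext_cubic E) (ext_e4c E).
- exact: chromatic_index4 (ext_4 E) (ext_n3 E).
- exact: girth5 (ext_C3 E) (ext_C4 E).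
Qed.

Lemma extendable_platypus (G : sgraph) (a b c d : G) : extendable a b c d -> platypus G.
Proof.
move=> E; split.
- by case: (extendable_snark E) => -[].
- by move/(hamiltonian_3_colorable (ext_cubic E))/(ext_n3 E).
by move=> v; have [u [s [us cnt _]]] := ext_vdel E v; apply: traceable_vdel us cnt.
Qed.

(* The Petersen graph minus two adjacent vertices x and y: a hamiltonian path 0, ..., 7 and three
   chords.  Vertices 0 and 7 were adjacent to x, vertices 2 and 5 to y. *)
Definition qadj : rel nat := fun i j =>
  [|| i.+1 == j, j.+1 == i, (i, j) \in [:: (0, 4); (1, 6); (3, 7)]
    | (j, i) \in [:: (0, 4); (1, 6); (3, 7)]].

Definition end_vertex : pred nat := fun q => q \in [:: 0; 7; 2; 5].

Lemma forall8 (P : pred nat) : all P (iota 0 8) -> forall q : 'I_8, P q.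
Proof. by move=> /allP h q; apply: h; rewrite mem_iota /= ltn_ord. Qed.

Lemma qadj_end (p q : 'I_8) : qadj p q -> end_vertex p -> ~~ end_vertex q.
Proof.
move=> pq ep; have /forall8/(_ q) := forall8 (P := fun p => all (fun q =>
  qadj p q && end_vertex p ==> ~~ end_vertex q) (iota 0 8)) isT p.
by rewrite pq ep.
Qed.

Lemma qadj_C3 (p q r : 'I_8) : qadj p q -> qadj q r -> ~~ qadj r p.
Proof.
move=> pq qr; have /forall8/(_ q)/forall8/(_ r) := forall8 (P := fun p => all (fun q =>
  all (fun r => qadj p q && qadj q r ==> ~~ qadj r p) (iota 0 8)) (iota 0 8)) isT p.
by rewrite pq qr.
Qed.

Lemma qadj_C4 (p q r s : 'I_8) :
  qadj p q -> qadj q r -> qadj r s -> qadj s p -> p != r -> q = s.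
Proof.
move=> pq qr rs sp pr; apply/val_inj/eqP.
have /forall8/(_ q)/forall8/(_ r)/forall8/(_ s) := forall8 (P := fun p => all (fun q =>
  all (fun r => all (fun s => [&& qadj p q, qadj q r, qadj r s, qadj s p & p != r] ==> (q == s))
  (iota 0 8)) (iota 0 8)) (iota 0 8)) isT p.
by rewrite pq qr rs sp pr.
Qed.

Section Extension.
Variables (G : sgraph) (a b c d : G).
Hypothesis ext : extendable a b c d.

Definition removed (u v : G) : bool :=
  [|| (u == a) && (v == b), (u == b) && (v == a),
      (u == c) && (v == d) | (u == d) && (v == c)].

Definition attach (q : nat) : option G :=
  match q with 0 => Some a | 7 => Some b | 2 => Some c | 5 => Some d | _ => None end.

Definition ext_rel : rel (G + 'I_8) := fun x y =>
  match x, y with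
  | inl u, inl v => adj u v && ~~ removed u v
  | inl u, inr q => attach q == Some u
  | inr q, inl u => attach q == Some u
  | inr p, inr q => qadj p q
  end.

Lemma removed_sym u v : removed u v = removed v u.
Proof.
rewrite /removed orbA [X in X || _]orbC -orbA; congr (_ || (_ || _));
  rewrite ?[_ && (v == _)]andbC //.
by rewrite orbC ![(v == _) && _]andbC.
Qed.

Lemma ext_sym : symmetric ext_rel.
Proof.
move=> [u|p] [v|q] //=; first by rewrite adj_sym removed_sym.
by rewrite /qadj /= orbCA; congr (_ || (_ || _)); rewrite orbC.
Qed.

Lemma ext_irrefl : irreflexive ext_rel.
Proof.
move=> [u|q] /=; first by rewrite adj_irrefl.
by apply/negbTE; apply: (forall8 (P := fun q => ~~ qadj q q)).
Qed.

Definition extension : sgraph := SGraph ext_sym ext_irrefl.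

Lemma attach_end (q : 'I_8) u : attach q == Some u -> end_vertex q.
Proof. by case: q => [[|[|[|[|[|[|[|[|]]]]]]]] ]. Qed.

Lemma attach_inj (p q : 'I_8) u : attach p == Some u -> attach q == Some u -> p = q.
Proof.
have := ext_uniq ext; rewrite /= !inE !negb_or.
move=> /and4P[/and3P[ab ac ad] /andP[bc bd] cd _] pu qu.
have := attach_end pu; have := attach_end qu; rewrite /end_vertex !inE.
move=> /or4P[]/eqP Eq /or4P[]/eqP Ep; apply: val_inj => /=; rewrite Ep Eq //;
  move: pu qu ab ac ad bc bd cd; rewrite Ep Eq /= => /eqP[->] /eqP[->];
  by rewrite eqxx ?andbF.
Qed.

(** The links between the old graph and the block form a matching, and their ends in the block are
    pairwise non-adjacent. So neither a triangle nor, in [extension_C4], a 4-cycle can cross between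
    the two. *)
Lemma extension_C3 (x y z : extension) : adj x y -> adj y z -> ~~ adj z x.
Proof.
move: x y z => [x|x] [y|y] [z|z] /=.
- move=> /andP[xy _] /andP[yz _]; by rewrite (negbTE (ext_C3 ext xy yz)).
- move=> /andP[xy _] /eqP->; by apply: contraTneq xy => -[->]; rewrite adj_irrefl.
- move=> /eqP-> /eqP[->]; by rewrite adj_irrefl.
- move=> xy yz; apply/negP=> /attach_end; apply/negP; exact: qadj_end yz (attach_end xy).
- move=> /eqP-> /andP[yz _]; apply: contraTneq yz => -[->]; by rewrite adj_irrefl.
- move=> xy yz; apply: contraTN (attach_end xy) => zx; exact: qadj_end zx (attach_end yz).
- move=> xy yz; apply/negP=> zx; have := qadj_end xy; by rewrite (attach_end yz) (attach_end zx)
  => /(_ isT).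
- exact: qadj_C3.
Qed.

Lemma extension_C4 (x y z w : extension) :
  adj x y -> adj y z -> adj z w -> adj w x -> x != z -> y = w.
Proof.
have no_ends (p q : 'I_8) u v : ~~ [&& qadj p q, attach p == Some u & attach q == Some v].
  apply/and3P=> -[pq /attach_end ep /attach_end].
  by apply/negP; exact: qadj_end pq ep.
have inl_eq q u v : attach q == Some u -> attach q == Some v -> u = v :> G.
  by move=> /eqP-> /eqP[].
move: x y z w => [x|x] [y|y] [z|z] [w|w] /= xy yz zw wx xz.
- congr inl; move: xy yz zw wx => /andP[xy _] /andP[yz _] /andP[zw _] /andP[wx _].
  by apply: (ext_C4 ext xy yz zw wx); apply: contra xz => /eqP->.
- by rewrite (inl_eq _ _ _ zw wx) eqxx in xz.
- by rewrite (inl_eq _ _ _ yz zw).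
- by have := no_ends z w y x; rewrite zw yz wx.
- by rewrite (inl_eq _ _ _ xy yz) eqxx in xz.
- by rewrite (attach_inj xy wx).
- by have := no_ends y z x w; rewrite yz xy zw.
- by rewrite (attach_inj xy wx).
- by rewrite (inl_eq _ _ _ xy wx).
- by have := no_ends w x z y; rewrite wx zw xy.
- by rewrite (inl_eq _ _ _ xy wx).
- by rewrite (attach_inj xy yz) eqxx in xz.
- by have := no_ends x y w z; rewrite xy wx yz.
- by rewrite (attach_inj yz zw).
- by rewrite (attach_inj zw wx) eqxx in xz.
- congr inr; apply: (qadj_C4 xy yz zw wx); by apply: contra xz => /eqP->.
Qed.
End Extension.

(** * Edge cuts of the extension *)

Definition end_bit (sa sb sc sd : bool) (q : nat) : option bool :=
  match q with 0 => Some sa | 7 => Some sb | 2 => Some sc | 5 => Some sd | _ => None end.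

(* The number of cut edges that meet the block, if [sa], [sb], [sc], [sd] tell the sides of the
   attachment vertices and [t] those of the block vertices. *)
Definition block_cut (sa sb sc sd : bool) (t : nat -> bool) : nat :=
  sumn [seq if end_bit sa sb sc sd q is Some s then nat_of_bool (s (+) t q) else 0
       | q <- iota 0 8] +
  sumn [seq sumn [seq nat_of_bool [&& qadj p q, t p & ~~ t q] | q <- iota 0 8] | p <- iota 0 8].

(* The last two clauses serve the cuts with at most one old vertex on one of the sides. *)
Definition block_cut_ok (sa sb sc sd : bool) (ts : seq bool) : bool :=
  let m := block_cut sa sb sc sd (nth false ts) in
  let k := count id ts in
  [&& (sa (+) sb) + (sc (+) sd) <= m,
      (sa + sb + sc + sd == 0) && (0 < k) ==> (if 1 < k then 3 < m else 2 < m) &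
      (sa + sb + sc + sd == 1) && (0 < k) ==> (1 < m)].

Fixpoint all_bits (n : nat) (P : seq bool -> bool) : bool :=
  if n is n'.+1 then
    if all_bits n' (fun s => P (true :: s)) then all_bits n' (fun s => P (false :: s)) else false
  else P [::].

Lemma all_bitsP n P : all_bits n P -> forall s, size s = n -> P s.
Proof.
elim: n P => [|n IH] P /=; first by move=> P0 [].
case: ifP => // /IH Pt /IH Pf [//|[] s] /= [sz]; [exact: Pt | exact: Pf].
Qed.

(** All 2^12 positions of the attachment and block vertices are checked. The first clause reflects
    the disjoint paths 0, 1, 6, 7 from [a] to [b] and 2, 3, 4, 5 from [c] to [d]. *)
Lemma block_cutP sa sb sc sd ts : size ts = 8 -> block_cut_ok sa sb sc sd ts.
Proof.
move: ts; apply: all_bitsP; move: [:: sa; sb; sc; sd] (erefl (size [:: sa; sb; sc; sd])).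
have : all_bits 4 (fun s =>
  if s is [:: sa; sb; sc; sd] then all_bits 8 (block_cut_ok sa sb sc sd) else true).
  by vm_compute.
by move/all_bitsP/(_ [:: sa; sb; sc; sd] erefl).
Qed.

Lemma sum_ord8 (F : nat -> nat) : \sum_(q < 8) F q = sumn [seq F q | q <- iota 0 8].
Proof. by rewrite sumnE big_map -(big_mkord xpredT) /index_iota subn0. Qed.

Lemma sum_some (T : finType) (o : option T) (P : pred T) :
  \sum_(u : T) ((o == Some u) && P u) = if o is Some u then nat_of_bool (P u) else 0.
Proof.
case: o => [v|]; last by rewrite big1.
rewrite (bigD1 v) //= eqxx big1 ?addn0 // => u uv.
by rewrite (inj_eq Some_inj) eq_sym (negbTE uv).
Qed.

Lemma sum_eq_and (T : finType) (v : T) (P : pred T) :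
  \sum_(u : T) ((u == v) && P u) = P v.
Proof.
rewrite (bigD1 v) //= eqxx big1 ?addn0 // => u uv.
by rewrite (negbTE uv).
Qed.

Lemma sum_eq_and2 (T : finType) (x y : T) (F : T -> T -> bool) :
  \sum_(u : T) \sum_(v : T) [&& u == x, v == y & F u v] = F x y.
Proof.
rewrite -(sum_eq_and x (F^~ y)); apply: eq_bigr => u _.
by rewrite -(sum_eq_and y (fun v => (u == x) && F u v)); apply: eq_bigr => v _; rewrite andbCA.
Qed.

Section ExtensionCuts.
Variables (G : sgraph) (a b c d : G).
Hypothesis ext : extendable a b c d.
Notation G' := (extension a b c d).

Lemma removedE u v : (removed a b c d u v : nat) =
  ((u == a) && (v == b)) + ((u == b) && (v == a)) + ((u == c) && (v == d)) + ((u == d) && (v ==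
    c)).
Proof.
have := ext_uniq ext; rewrite /= !inE !negb_or => /and4P[/and3P[ab ac ad] /andP[bc bd] cd _].
rewrite /removed; case: (eqVneq u a) => [->|_] /=.
  by rewrite (negbTE ab) (negbTE ac) (negbTE ad) /= orbF !addn0.
case: (eqVneq u b) => [->|_] /=; first by rewrite (negbTE bc) (negbTE bd) /= orbF !addn0.
case: (eqVneq u c) => [->|_] /=; first by rewrite (negbTE cd) /= orbF !addn0.
by case: (eqVneq u d).
Qed.

Lemma removed_adj u v : removed a b c d u v -> adj u v.
Proof.
by move=> /or4P[]/andP[/eqP-> /eqP->]; rewrite 1?adj_sym ?(ext_ab ext) ?(ext_cd ext) // adj_sym
  ?(ext_ab ext) ?(ext_cd ext).
Qed.

Lemma sum_removed (F : G -> G -> bool) :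
  \sum_(u : G) \sum_(v : G) (removed a b c d u v && F u v) = F a b + F b a + F c d + F d c.
Proof.
have E u v : (removed a b c d u v && F u v : nat) =
  ((u == a) && ((v == b) && F u v)) + ((u == b) && ((v == a) && F u v)) +
  ((u == c) && ((v == d) && F u v)) + ((u == d) && ((v == c) && F u v)).
  by rewrite !andbA -!mulnb -!mulnDl !mulnb -removedE mulnb.
under eq_bigr do under eq_bigr do rewrite E.
under eq_bigr do rewrite !big_split /=.
by rewrite !big_split /= !sum_eq_and2.
Qed.

(** At an old vertex the removed edges are replaced, one for one, by links to the block. *)
Lemma extension_cubic : cubic G'.
Proof.
move=> [u|q]; rewrite cubic_sum big_sumType /=.
  rewrite -[RHS](ext_cubic ext u) cubic_sum.
  transitivity (\sum_v (adj u v && ~~ removed a b c d u v) + \sum_v removed a b c d u v).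
    congr (_ + _); under [RHS]eq_bigr do rewrite removedE.
    rewrite !big_split (sum_ord8 (fun q => nat_of_bool (attach a b c d q == Some u))) /=.
    have E (x y : G) : \sum_v ((u == x) && (v == y)) = (x == u).
      under eq_bigr do rewrite andbC; by rewrite sum_eq_and eq_sym.
    rewrite !E !(inj_eq Some_inj) /=.
    by rewrite !add0n addn0 -!addnA ; congr (_ + _); rewrite addnA addnC.
  rewrite -big_split /=; apply: eq_bigr => v _.
  by case: (boolP (removed _ _ _ _ _ _)) => [/removed_adj->|_] //; rewrite andbT addn0.
rewrite (sum_ord8 (fun i => nat_of_bool (qadj q i))).
have -> : \sum_(i : G) (attach a b c d q == Some i) = end_vertex q.
  under eq_bigr do rewrite -[_ == _]andbT.
  rewrite (sum_some _ predT).
  by case: q => [[|[|[|[|[|[|[|[|]]]]]]]] ].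
apply/eqP/(forall8 (P := fun p => end_vertex p + sumn [seq nat_of_bool (qadj p q) | q <- iota 0
  8] == 3)).
by vm_compute.
Qed.

(** The cut loses the removed edges that it contained and gains the edges that meet the block; both
    sides are sums, to avoid truncated subtraction. *)
Lemma extension_boundary (S' : {set G'}) :
  let S := [set u | inl u \in S'] in
  boundary S' + (((a \in S) (+) (b \in S)) + ((c \in S) (+) (d \in S))) =
  boundary S + block_cut (a \in S) (b \in S) (c \in S) (d \in S)
    (nth false [seq inr q \in S' | q <- enum 'I_8]).
Proof.
move=> S.
have nthE (q : 'I_8) : nth false [seq inr q \in S' | q <- enum 'I_8] q = (inr q \in S').
  by rewrite (nth_map q) ?size_enum_ord // nth_ord_enum.
set t := nth false _ in nthE *.
have -> : boundary S' = \sum_u \sum_v [&& adj u v && ~~ removed a b c d u v, u \in S & v \notin S]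
    + \sum_(q < 8) (if end_bit (a \in S) (b \in S) (c \in S) (d \in S) q is Some s
                   then nat_of_bool (s (+) t q) else 0)
    + \sum_(p < 8) \sum_(q < 8) [&& qadj p q, t p & ~~ t q].
  rewrite /boundary big_sumType /=.
  under eq_bigr do rewrite big_sumType /=.
  under [X in _ + X]eq_bigr do rewrite big_sumType /=.
  rewrite !big_split /= !addnA; congr (_ + _); last first.
    by apply: eq_bigr => p _; apply: eq_bigr => q _; rewrite !nthE.
  rewrite -addnA; congr (_ + _).
    by apply: eq_bigr => u _; apply: eq_bigr => v _; rewrite !inE.
  rewrite exchange_big -big_split /=; apply: eq_bigr => q _.
  rewrite !sum_some nthE !inE; move: (inr q \in S') => e.
  by case: q => [[|[|[|[|[|[|[|[|]]]]]]]] ] //= _; case: (inl _ \in S') e => -[].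
have -> : boundary S = \sum_u \sum_v [&& adj u v && ~~ removed a b c d u v, u \in S & v \notin S]
    + (((a \in S) (+) (b \in S)) + ((c \in S) (+) (d \in S))).
  transitivity (\sum_u \sum_v [&& adj u v && ~~ removed a b c d u v, u \in S & v \notin S]
    + \sum_u \sum_v [&& removed a b c d u v, u \in S & v \notin S]).
    rewrite -big_split; apply: eq_bigr => u _; rewrite -big_split; apply: eq_bigr => v _ /=.
    by case: (boolP (removed _ _ _ _ _ _)) => [/removed_adj->|_]; rewrite ?andbF ?andbT ?addn0.
  rewrite sum_removed; congr (_ + _).
  by do 4!case: (_ \in S).
rewrite /block_cut -[sumn [seq sumn _ | _ <- _]]sum_ord8 -sum_ord8.
have -> : \sum_(p < 8) \sum_(q < 8) [&& qadj p q, t p & ~~ t q] =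
  \sum_(p < 8) sumn [seq nat_of_bool [&& qadj p q, t p & ~~ t q] | q <- iota 0 8].
  by apply: eq_bigr => p _; rewrite -sum_ord8.
by rewrite [RHS]addnA addnAC; congr (_ + _); rewrite addnAC.
Qed.

(** With no old vertex in [S'] the block alone provides the cut. With one, its boundary 3 and the
    edges cut at the block outweigh the at most one removed edge at that vertex. *)
Lemma extension_e4c_half (S' : {set G'}) :
  #|[set u | inl u \in S']| <= 1 -> 1 < #|S'| -> 3 < boundary S'.
Proof.
have := extension_boundary S'; set S := [set u | _]; set ts := [seq _ | q <- _] => /= E S1.
have sz : size ts = 8 by rewrite size_map size_enum_ord.
have -> : #|S'| = #|S| + count id ts.
  rewrite -sum1_card big_mkcond big_sumType /=; congr (_ + _).
    by rewrite -sum1_card [RHS]big_mkcond; apply: eq_bigr => u _; rewrite inE.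
  rewrite count_map -sum1_count -big_enum [LHS]big_mkcond [RHS]big_mkcond /=.
  by apply: eq_bigr.
have := ext_uniq ext; rewrite /= !inE !negb_or => /and4P[/and3P[ab ac ad] /andP[bc bd] cd _].
have := block_cutP (a \in S) (b \in S) (c \in S) (d \in S) sz.
rewrite /block_cut_ok; set m := block_cut _ _ _ _ _ in E *; set k := count id ts.
move: S1; rewrite leq_eqVlt ltnS leqn0 => /orP[/cards1P[u Su]|].
  rewrite Su cards1 ltnS => /and3P[m0 m1 m2] k0; move: m0 m1 m2 E.
  rewrite Su (boundary1 _ (ext_cubic ext)) !inE k0 !andbT.
  have : (a == u) + (b == u) + (c == u) + (d == u) <= 1.
    case: (eqVneq a u) ab ac ad => [<-|_ _ _ _].
      by rewrite ![a == _]eq_sym => /negbTE-> /negbTE-> /negbTE->.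
    case: (eqVneq b u) bc bd => [<-|_ _ _].
      by rewrite ![b == _]eq_sym => /negbTE-> /negbTE->.
    case: (eqVneq c u) cd => [<-|_ _]; last by case: (d == u).
    by rewrite eq_sym => /negbTE->.
  move: (a == u) (b == u) (c == u) (d == u) => [] [] [] [] //= _; case: (1 < k); lia.
rewrite cards_eq0 => /eqP S0; rewrite S0 cards0 !inE /= => /andP[+ _] k1.
rewrite k1 (ltn_trans _ k1) //= => m3; move: E; rewrite S0 !inE /= !addn0 => ->.
by rewrite (leq_trans m3) ?leq_addl.
Qed.

(** With two old vertices on either side, the cut of [G] exceeds 3 and the block makes up for the
    removed edges; otherwise [extension_e4c_half] applies to [S'] or to its complement. *)
Lemma extension_e4c : essentially_4_edge_connected G'.
Proof.
move=> S' S1 S1'; pose S := [set u | inl u \in S'].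
have [h|h] := leqP #|S| 1; first exact: extension_e4c_half.
have [h'|h'] := leqP #|~: S| 1.
  rewrite -boundaryC; apply: extension_e4c_half => //.
  by rewrite (_ : [set u | _] = ~: S) //; apply/setP=> u; rewrite !inE.
have := extension_boundary S'; rewrite /= -/S; have := ext_e4c ext h h'.
set ts := [seq _ | q <- _] => b4.
have sz : size ts = 8 by rewrite size_map size_enum_ord.
have /and3P[+ _ _] := block_cutP (a \in S) (b \in S) (c \in S) (d \in S) sz.
move=> /(leq_add b4) + E; by rewrite -E leq_add2r.
Qed.
End ExtensionCuts.

(** * Edge colourings of the extension *)

Definition rainbow (x y z : nat) : bool :=
  [&& x < 3, y < 3, z < 3, x != y, x != z & y != z].

(** The colours 0, 1 and 2 add up to 3. *)
Lemma rainbowE x y z : rainbow x y z -> z = 3 - x - y.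
Proof. by rewrite /rainbow; lia. Qed.

Lemma block_3coloring (x0 x7 x2 x5 y01 y12 y23 y34 y45 y56 y67 y04 y16 y37 : nat) :
  rainbow x0 y01 y04 -> rainbow y01 y12 y16 -> rainbow y12 y23 x2 ->
  rainbow y23 y34 y37 -> rainbow y34 y04 y45 -> rainbow y45 y56 x5 ->
  rainbow y56 y16 y67 -> rainbow y67 y37 x7 -> x0 = x7 /\ x2 = x5.
Proof.
move=> r0 r1 r2 r3 r4 r5 r6 r7.
(* Six of the fourteen colours determine the other eight, which leaves 3^6 cases. *)
have E04 := rainbowE r0; have E16 := rainbowE r1; have E2 := rainbowE r2.
have E37 := rainbowE r3; have E45 := rainbowE r4; have E5 := rainbowE r5.
have E67 := rainbowE r6; have E7 := rainbowE r7; subst.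
have lt3 x y z : rainbow x y z -> (x \in iota 0 3) && (y \in iota 0 3).
  by move=> /and4P[x3 y3 _ _]; rewrite !mem_iota x3 y3.
have /andP[i0 i01] := lt3 _ _ _ r0; have /andP[_ i12] := lt3 _ _ _ r1.
have /andP[i23 i34] := lt3 _ _ _ r3; have /andP[_ i56] := lt3 _ _ _ r5.
move: r0 r1 r2 r3 r4 r5 r6 r7.
suff : all (fun x0 => all (fun y01 => all (fun y12 => all (fun y23 => all (fun y34 => all (fun
  y56 =>
  let y04 := 3 - x0 - y01 in let y16 := 3 - y01 - y12 in let x2 := 3 - y12 - y23 in
  let y37 := 3 - y23 - y34 in let y45 := 3 - y34 - y04 in let x5 := 3 - y45 - y56 in
  let y67 := 3 - y56 - y16 in let x7 := 3 - y67 - y37 in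
  [&& rainbow x0 y01 y04, rainbow y01 y12 y16, rainbow y12 y23 x2,
    rainbow y23 y34 y37, rainbow y34 y04 y45, rainbow y45 y56 x5,
    rainbow y56 y16 y67 & rainbow y67 y37 x7] ==> ((x0 == x7) && (x2 == x5)))
  (iota 0 3)) (iota 0 3)) (iota 0 3)) (iota 0 3)) (iota 0 3)) (iota 0 3).
  move=> /allP/(_ _ i0)/allP/(_ _ i01)/allP/(_ _ i12)/allP/(_ _ i23)/allP/(_ _ i34)/allP/(_ _
    i56).
  move=> /= h r0 r1 r2 r3 r4 r5 r6 r7; move: h.
  by rewrite r0 r1 r2 r3 r4 r5 r6 r7 => /andP[/eqP ? /eqP].
by vm_compute.
Qed.

Definition block_edges :=
  [:: (0, 1); (1, 2); (2, 3); (3, 4); (4, 5); (5, 6); (6, 7); (0, 4); (1, 6); (3, 7)].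

Definition end_color (x y q : nat) : nat := if q \in [:: 0; 7] then x else y.

(* In the patterns, colour 0 is that of the edges at 0 and 7, and colour 1 that of the edges at
   2 and 5 if it is different; the palette translates them into [x] and [y]. *)
Definition block_color (x y p q : nat) : nat :=
  let palette := rev (undup [:: 3; 2; 1; 0; y; x]) in
  let pattern := if x == y then [:: 1; 2; 1; 0; 1; 2; 1; 2; 0; 2]
                 else [:: 1; 2; 0; 1; 0; 2; 1; 2; 0; 2] in
  nth 0 palette (nth 0 pattern (index (minn p q, maxn p q) block_edges)).

Lemma block_colorP (x y : 'I_4) (p q r : 'I_8) : qadj p q ->
  [/\ block_color x y p q < 4,
      end_vertex p -> end_color x y p != block_color x y p q &
      qadj p r -> q != r -> block_color x y p q != block_color x y p r].
Proof.
move=> pq; have h : all (fun x => all (fun y => all (fun p => all (fun q => qadj p q ==>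
  [&& block_color x y p q < 4, end_vertex p ==> (end_color x y p != block_color x y p q) &
    all (fun r => qadj p r && (q != r) ==> (block_color x y p q != block_color x y p r)) (iota 0
      8)])
  (iota 0 8)) (iota 0 8)) (iota 0 4)) (iota 0 4) by vm_compute.
have io n (i : 'I_n) : val i \in iota 0 n by rewrite mem_iota /= ltn_ord.
move: h => /allP/(_ _ (io _ x))/allP/(_ _ (io _ y))/allP/(_ _ (io _ p))/allP/(_ _ (io _ q)).
rewrite pq => /and3P[lt4 /implyP e /allP/(_ _ (io _ r))/implyP h]; split=> // pr qr.
by apply: h; rewrite pr.
Qed.

Section ExtensionColorings.
Variables (G : sgraph) (a b c d : G).
Hypothesis ext : extendable a b c d.
Notation G' := (extension a b c d).

Definition block_vertex (q : nat) (q8 : q < 8) : G' := inr (Ordinal q8).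

(** With [new_neighbor u] this matches the neighbours of [u] in [G'] and in [G]: a link stands for
    the removed edge at its old end, so the link from [a] to 0 corresponds to [b]. *)
Definition old_neighbor (u : G) (y : G') : G :=
  match y with
  | inl v => v
  | inr q => match val q with 0 => b | 7 => a | 2 => d | _ => c end
  end.

Definition new_neighbor (u v : G) : G' :=
  if (u == a) && (v == b) then block_vertex (isT : 0 < 8)
  else if (u == b) && (v == a) then block_vertex (isT : 7 < 8)
  else if (u == c) && (v == d) then block_vertex (isT : 2 < 8)
  else if (u == d) && (v == c) then block_vertex (isT : 5 < 8)
  else inl v.

Lemma new_neighborK u : cancel (new_neighbor u) (old_neighbor u).
Proof.
by move=> v; rewrite /new_neighbor; do 4?[case: ifP => [/andP[_ /eqP->]//|_]].
Qed.

Lemma new_neighbor_adj u v : adj u v -> @adj G' (inl u) (new_neighbor u v).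
Proof.
move=> uv; rewrite /new_neighbor.
do 4?[case: ifP => [/andP[/eqP-> _]|?]]; rewrite /= ?eqxx // uv /removed.
by apply/norP; split; [|apply/norP; split; [|apply/norP; split]]; apply/negbT.
Qed.

Lemma new_neighbor_inl u v : ~~ removed a b c d u v -> new_neighbor u v = inl v.
Proof.
case/norP=> /negbTE n1 /norP[/negbTE n2 /norP[/negbTE n3 /negbTE n4]].
by rewrite /new_neighbor n1 n2 n3 n4.
Qed.

Lemma new_neighbor_removed :
  [/\ new_neighbor a b = block_vertex (isT : 0 < 8), new_neighbor b a = block_vertex (isT : 7 <
    8),
      new_neighbor c d = block_vertex (isT : 2 < 8) & new_neighbor d c = block_vertex (isT : 5 <
        8)].
Proof.
have := ext_uniq ext; rewrite /= !inE !negb_or.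
move=> /and4P[/and3P[/negbTE ab /negbTE ac /negbTE ad] /andP[/negbTE bc /negbTE bd] /negbTE cd _].
by rewrite /new_neighbor !eqxx ![_ == a]eq_sym ![_ == b]eq_sym ![d == c]eq_sym
  ?[b == a]eq_sym ab ac ad bc bd cd.
Qed.

Lemma old_neighborK u v : @adj G' (inl u) v -> new_neighbor u (old_neighbor u v) = v.
Proof.
have [Eab Eba Ecd Edc] := new_neighbor_removed.
case: v => [v /andP[_ /new_neighbor_inl]//|q] /=.
by case: q => [[|[|[|[|[|[|[|[|]]]]]]]] ] //= q8 /eqP[<-]; rewrite ?Eab ?Eba ?Ecd ?Edc;
  congr inr; apply: val_inj.
Qed.

Lemma old_neighbor_adj u v : @adj G' (inl u) v -> adj u (old_neighbor u v).
Proof.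
case: v => [v /andP[]//|q] /=.
by case: q => [[|[|[|[|[|[|[|[|]]]]]]]] ] //= q8 /eqP[<-]; rewrite ?(ext_ab ext) ?(ext_cd ext)
  // adj_sym ?(ext_ab ext) ?(ext_cd ext).
Qed.

Lemma extension_n3 : ~ k_colorable G' 3.
Proof.
case=> f fS fP; apply: (ext_n3 ext).
have rb (x y z w : G') : adj x y -> adj x z -> adj x w -> y != z -> y != w -> z != w ->
    rainbow (f x y) (f x z) (f x w).
  move=> xy xz xw yz yw zw; rewrite /rainbow !fP // andbT.
  by rewrite (fS _ _ xy).2 (fS _ _ xz).2 (fS _ _ xw).2.
pose q i (h : i < 8) : G' := block_vertex h.
have [E07 E25] : f (inl a) (@q 0 isT) = f (inl b) (@q 7 isT) /\
                 f (inl c) (@q 2 isT) = f (inl d) (@q 5 isT).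
  pose g i j (hi : i < 8) (hj : j < 8) := f (q i hi) (q j hj).
  have gS i j (hi : i < 8) (hj : j < 8) : qadj i j -> g i j hi hj = g j i hj hi.
    by move=> ij; case: (fS (q i hi) (q j hj) ij).
  have Sa : f (inl a) (@q 0 isT) = f (@q 0 isT) (inl a) by apply: (fS _ _ _).1; rewrite /= eqxx.
  have Sb : f (inl b) (@q 7 isT) = f (@q 7 isT) (inl b) by apply: (fS _ _ _).1; rewrite /= eqxx.
  have Sc : f (inl c) (@q 2 isT) = f (@q 2 isT) (inl c) by apply: (fS _ _ _).1; rewrite /= eqxx.
  have Sd : f (inl d) (@q 5 isT) = f (@q 5 isT) (inl d) by apply: (fS _ _ _).1; rewrite /= eqxx.
  rewrite Sa Sb Sc Sd.
  apply: (block_3coloring (y01 := g 0 1 isT isT) (y12 := g 1 2 isT isT) (y23 := g 2 3 isT isT)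
    (y34 := g 3 4 isT isT) (y45 := g 4 5 isT isT) (y56 := g 5 6 isT isT) (y67 := g 6 7 isT isT)
    (y04 := g 0 4 isT isT) (y16 := g 1 6 isT isT) (y37 := g 3 7 isT isT)).
  - by apply: rb; rewrite //= ?eqxx.
  - rewrite [g 0 1 _ _]gS //; by apply: rb; rewrite //= ?eqxx.
  - rewrite [g 1 2 _ _]gS //; by apply: rb; rewrite //= ?eqxx.
  - rewrite [g 2 3 _ _]gS //; by apply: rb; rewrite //= ?eqxx.
  - rewrite [g 3 4 _ _]gS // [g 0 4 _ _]gS //; by apply: rb; rewrite //= ?eqxx.
  - rewrite [g 4 5 _ _]gS //; by apply: rb; rewrite //= ?eqxx.
  - rewrite [g 5 6 _ _]gS // [g 1 6 _ _]gS //; by apply: rb; rewrite //= ?eqxx.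
  - rewrite [g 6 7 _ _]gS // [g 3 7 _ _]gS //; by apply: rb; rewrite //= ?eqxx.
(* A removed edge takes the colour of the links replacing it; [E07] and [E25] make this independent
   of the end from which it is seen. *)
exists (fun u v => f (inl u) (new_neighbor u v)) => [u v uv|u v w uv uw vw].
  split; last exact: (fS _ _ (new_neighbor_adj uv)).2.
  have [Eab Eba Ecd Edc] := new_neighbor_removed.
  case: (boolP (removed a b c d u v)) => [|nr].
    by case/or4P=> /andP[/eqP-> /eqP->]; rewrite ?Eab ?Eba ?Ecd ?Edc.
  rewrite !new_neighbor_inl // 1?removed_sym //.
  by apply: (fS _ _ _).1; rewrite /= uv.
apply: fP; [exact: new_neighbor_adj|exact: new_neighbor_adj|].
by apply: contra vw => /eqP/(can_inj (new_neighborK u)) ->.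
Qed.

(** The links at 0 and 7 inherit the colour of [ab] and those at 2 and 5 that of [cd], so old
    vertices see the same colours as before, and [block_color] fills the block. *)
Lemma extension_4 : k_colorable G' 4.
Proof.
have [f fS fP] := ext_4 ext.
have [_ ab4] := fS _ _ (ext_ab ext); have [_ cd4] := fS _ _ (ext_cd ext).
pose x := Ordinal ab4; pose y := Ordinal cd4.
pose g (u v : G') : nat := match u, v with
  | inl u, inl v => f u v
  | inl u, inr q => end_color x y q
  | inr q, inl u => end_color x y q
  | inr p, inr q => block_color x y p q
  end.
have gE u v : @adj G' (inl u) v -> g (inl u) v = f u (old_neighbor u v).
  case: v => [//|q] /=; rewrite /end_color.
  by case: q => [[|[|[|[|[|[|[|[|]]]]]]]] ] //= _ /eqP[<-]; rewrite // (fS _ _ _).1 ?(ext_ab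
    ext) ?(ext_cd ext).
exists g => [u v uv|u v w uv uw vw].
  case: u v uv => [u|p] [v|q] uv.
  - by move: uv => /andP[/fS].
  - by split=> //=; rewrite /end_color; case: ifP.
  - by split=> //=; rewrite /end_color; case: ifP.
  - split; last by case: (block_colorP x y p uv).
    by rewrite /= /block_color minnC maxnC.
case: u uv uw => [u|p] uv uw.
  rewrite !gE // fP ?old_neighbor_adj //; apply: contra vw => /eqP E.
  by rewrite -(old_neighborK uv) E old_neighborK.
case: v w uv uw vw => [v|q] [w|r] /= pv pw vw.
- by move: pv vw => /eqP E; move: pw; rewrite E => /eqP[->]; rewrite eqxx.
- by have [_ h _] := block_colorP x y p pw; apply: h; exact: attach_end pv.
- by have [_ h _] := block_colorP x y p pv; rewrite eq_sym; apply: h; exact: attach_end pw.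
- by have [_ _ h] := block_colorP x y r pv; apply: h.
Qed.
End ExtensionColorings.

(** * Spanning paths of the extension *)

Section Uses.
Variable T : eqType.
Implicit Types (x y u : T) (s : seq T).

Lemma uses_cat x y u s1 s2 : uses x y u (s1 ++ s2) = uses x y u s1 + uses x y (last u s1) s2.
Proof. by elim: s1 u => //= v s1 IH u; rewrite IH addnA. Qed.

Lemma uses_notin x y u s : x \notin u :: s -> uses x y u s = 0.
Proof.
elim: s u => //= v s IH u; rewrite inE negb_or => /andP[xu xvs].
have xv : x != v by apply: contra xvs => /eqP->; rewrite mem_head.
by rewrite IH // ![_ == x]eq_sym (negbTE xu) (negbTE xv) andbF.
Qed.

Lemma usesC x y u s : uses x y u s = uses y x u s.
Proof. by elim: s u => //= v s IH u; rewrite IH orbC. Qed.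

Lemma uses_le1 x y u s : uniq (u :: s) -> uses x y u s <= 1.
Proof.
elim: s u => //= v s IH u /andP[uvs uq].
case: (boolP ((u == x) && (v == y) || (u == y) && (v == x))) => [uv|_]; last exact: IH.
rewrite -[1]addn0 leq_add2l leqn0.
by case/orP: uv => /andP[/eqP ux /eqP vy]; [|rewrite usesC]; rewrite uses_notin // -ux.
Qed.
End Uses.

Definition block_path (x y : nat) (L : seq nat) : bool :=
  if L is z :: L' then
    [&& all (ltn^~ 8) L, z == x, path qadj z L' & last z L' == y]
  else false.

Section ExtensionPaths.
Variables (G : sgraph) (a b c d : G).
Hypothesis ext : extendable a b c d.
Notation G' := (extension a b c d).

Definition block_seq (L : seq nat) : seq G' := [seq inr (inord q) | q <- L].

Lemma block_seq_behead x y i L : block_path x y (i :: L) ->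
  path (@adj G') (inr (inord i)) (block_seq L).
Proof.
case/and4P=> L8 _ iL _; rewrite path_map.
apply: (sub_in_path (P := ltn^~ 8)) iL; last exact: L8.
by move=> p q p8 q8 /=; rewrite !inordK.
Qed.

Lemma block_seq_path x y L (z : G') t : block_path x y L ->
  path (@adj G') z (block_seq L ++ t) = adj z (inr (inord x)) && path (@adj G') (inr (inord y)) t.
Proof.
case: L => // i L iL; have /and4P[_ /eqP ix _ /eqP Ly] := iL.
by rewrite /= cat_path last_map (block_seq_behead iL) Ly ix.
Qed.

Lemma last_block_seq x y L (z : G') : block_path x y L -> last z (block_seq L) = inr (inord y).
Proof. by case: L => // i L /and4P[_ _ _ /eqP<-] /=; rewrite last_map. Qed.

Lemma count_block_seq (q : 'I_8) L : all (ltn^~ 8) L ->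
  count_mem (inr q : G') (block_seq L) = count_mem (val q) L.
Proof.
move=> /allP L8; rewrite count_map; apply: eq_in_count => p /L8 p8 /=.
apply/eqP/eqP=> [[<-]|->]; first by rewrite inordK.
by rewrite inord_val.
Qed.

Lemma count_block_seq_inl u L : count_mem (inl u : G') (block_seq L) = 0.
Proof. by rewrite count_map; apply: count_pred0. Qed.

Lemma count_map_inl u s : count_mem (inl u : G') (map inl s) = count_mem u s.
Proof. by rewrite count_map; apply: eq_count => v /=; rewrite (inj_eq (@inl_inj _ _)). Qed.

Lemma count_map_inl_inr (q : 'I_8) (s : seq G) : count_mem (inr q : G') (map inl s) = 0.
Proof. by rewrite count_map; apply: count_pred0. Qed.

Lemma block_adj u q : q < 8 -> attach a b c d q = Some u ->
  @adj G' (inl u) (inr (inord q)) /\ @adj G' (inr (inord q)) (inl u).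
Proof. by move=> q8 E; rewrite /= inordK // E eqxx. Qed.

Section Detour.
Variables PE PF : seq nat.
Hypotheses (hPE : block_path 0 7 PE) (hPE' : block_path 7 0 (rev PE)).
Hypotheses (hPF : block_path 2 5 PF) (hPF' : block_path 5 2 (rev PF)).

(** The reversed lists serve a traversal of the marked edge in the opposite direction. *)
Definition detour (u v : G) : seq nat :=
  if (u == a) && (v == b) then PE else if (u == b) && (v == a) then rev PE
  else if (u == c) && (v == d) then PF else if (u == d) && (v == c) then rev PF
  else [::].

Fixpoint expand (u : G) (s : seq G) : seq G' :=
  if s is v :: s' then block_seq (detour u v) ++ inl v :: expand v s' else [::].

Lemma expand_path u s : path (@adj G) u s -> path (@adj G') (inl u) (expand u s).
Proof.
have [a0 a0'] := @block_adj a 0 isT erefl; have [b7 b7'] := @block_adj b 7 isT erefl.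
have [c2 c2'] := @block_adj c 2 isT erefl; have [d5 d5'] := @block_adj d 5 isT erefl.
elim: s u => //= v s IH u /andP[uv /IH vs].
rewrite /detour; case: ifP => [/andP[/eqP Eu /eqP Ev]|n1].
  by rewrite (block_seq_path _ _ hPE) Eu; apply/andP; split;
    [exact: a0|rewrite [path _ _ _]/= vs andbT Ev; exact: b7'].
case: ifP => [/andP[/eqP Eu /eqP Ev]|n2].
  by rewrite (block_seq_path _ _ hPE') Eu; apply/andP; split;
    [exact: b7|rewrite [path _ _ _]/= vs andbT Ev; exact: a0'].
case: ifP => [/andP[/eqP Eu /eqP Ev]|n3].
  by rewrite (block_seq_path _ _ hPF) Eu; apply/andP; split;
    [exact: c2|rewrite [path _ _ _]/= vs andbT Ev; exact: d5'].
case: ifP => [/andP[/eqP Eu /eqP Ev]|n4].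
  by rewrite (block_seq_path _ _ hPF') Eu; apply/andP; split;
    [exact: d5|rewrite [path _ _ _]/= vs andbT Ev; exact: c2'].
by rewrite /= uv vs /removed n1 n2 n3 n4.
Qed.

Lemma block_path8 x y L : block_path x y L -> all (ltn^~ 8) L.
Proof. by case: L => // i L /and4P[]. Qed.

Lemma expand_count_inl u s w : count_mem (inl w) (expand u s) = count_mem w s.
Proof.
elim: s u => //= v s IH u.
by rewrite count_cat count_block_seq_inl /= IH (inj_eq (@inl_inj _ _)).
Qed.

(** Each passage through a marked edge inserts one copy of its list, in either direction, so the
    coverage of the block depends only on the numbers of uses. *)
Lemma expand_count_inr u s (q : 'I_8) : count_mem (inr q) (expand u s) =
  uses a b u s * count_mem (val q) PE + uses c d u s * count_mem (val q) PF.
Proof.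
have := ext_uniq ext; rewrite /= !inE !negb_or.
move=> /and4P[/and3P[/negbTE ab /negbTE ac /negbTE ad] /andP[/negbTE bc /negbTE bd] /negbTE cd _].
elim: s u => //= v s IH u.
rewrite count_cat /= IH add0n !mulnDl addnACA; congr (_ + _).
rewrite count_block_seq; last first.
  by rewrite /detour; do 4?[case: ifP => _]; rewrite // (block_path8 hPE, block_path8 hPE',
    block_path8 hPF, block_path8 hPF').
rewrite /detour; case: (boolP ((u == a) && (v == b))) => [/andP[/eqP-> /eqP->]|n1].
  by rewrite ac ad mul1n addn0.
case: (boolP ((u == b) && (v == a))) => [/andP[/eqP-> /eqP->]|n2].
  by rewrite bc bd count_rev mul1n addn0.
case: (boolP ((u == c) && (v == d))) => [_|n3]; first by rewrite mul1n.
by case: (boolP ((u == d) && (v == c))) => [_|n4]; rewrite ?count_rev ?mul1n.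
Qed.

(** The detour leaves or enters [a] through block vertex 0, and this link is the new marked edge at
    [a]. *)
Lemma expand_uses_ab u s :
  uses a b u s <= uses (inl a) (inr (inord 0)) (inl u) (expand u s).
Proof.
elim: s u => //= v s IH u; rewrite uses_cat /= addnA leq_add //.
case: (boolP ((u == a) && (v == b))) => [uv|n1] /=.
  rewrite /detour uv; case: PE hPE => //= z L /and4P[_ /eqP-> _ _] /=.
  by case/andP: uv => /eqP-> _; rewrite !eqxx.
case: (boolP ((u == b) && (v == a))) => [uv|//].
rewrite /detour (negbTE n1) uv (last_block_seq _ hPE').
by case/andP: uv => _ /eqP->; rewrite !eqxx orbT addn1.
Qed.

Lemma expand_uses_cd u s :
  uses c d u s <= uses (inl c) (inr (inord 2)) (inl u) (expand u s).
Proof.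
have := ext_uniq ext; rewrite /= !inE !negb_or.
move=> /and4P[/and3P[_ /negbTE ac /negbTE ad] /andP[/negbTE bc /negbTE bd] /negbTE cd _].
elim: s u => //= v s IH u; rewrite uses_cat /= addnA leq_add //.
case: (boolP ((u == c) && (v == d))) => [/andP[/eqP-> /eqP->]|n1] /=.
  rewrite /detour ![c == _]eq_sym ac bc !eqxx /=.
  by case: PF hPF => //= z L /and4P[_ /eqP-> _ _] /=; rewrite !eqxx.
case: (boolP ((u == d) && (v == c))) => [/andP[/eqP-> /eqP->]|//].
rewrite /detour ![d == _]eq_sym ad bd cd !eqxx /= (last_block_seq _ hPF').
by rewrite !eqxx orbT addn1.
Qed.
End Detour.

Lemma uses_map_inl u s x q : uses (inl x : G') (inr q) (inl u) (map inl s) = 0.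
Proof. by elim: s u => //= v s IH u; rewrite IH andbF. Qed.

Lemma lift_path u s : path (@adj G) u s -> uses a b u s = 0 -> uses c d u s = 0 ->
  path (@adj G') (inl u) (map inl s).
Proof.
elim: s u => //= v s IH u /andP[uv vs] /eqP + /eqP.
rewrite !addn_eq0 !eqb0 => /andP[nab /eqP ab0] /andP[ncd /eqP cd0].
by rewrite uv IH // andbT /removed !orbA -orbA negb_or nab.
Qed.

(** The vertices [a], 0, [c], 2 take over the roles of [a], [b], [c], [d]. The old path from [a] to
    [d] continues from 5 along a spanning path of the block to 2. *)
Lemma extension_ad : spanning_path (inl a : G') (inr (inord 0)) (inl c) (inr (inord 2))
  (inl a) (inr (inord 2)).
Proof.
have [s [pas lasts cnts nab ncd]] := ext_ad ext.
have := ext_uniq ext; rewrite /= !inE !negb_or.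
move=> /and4P[/and3P[_ _ /negbTE ad] _ /negbTE cd _].
have bp : block_path 5 2 [:: 5; 6; 7; 3; 4; 0; 1; 2] by [].
exists (map inl s ++ block_seq [:: 5; 6; 7; 3; 4; 0; 1; 2]); split.
- rewrite cat_path lift_path // last_map lasts -[block_seq _]cats0 (block_seq_path _ _ bp) andbT.
  by case: (@block_adj d 5 isT erefl).
- by rewrite last_cat (last_block_seq _ bp).
- move=> [u|q]; rewrite -cat_cons count_cat -[inl a :: _]/(map inl (a :: s)).
    by rewrite count_map_inl cnts count_block_seq_inl.
  rewrite count_map_inl_inr count_block_seq // add0n.
  exact/eqP/(forall8 (P := fun q => count_mem q [:: 5; 6; 7; 3; 4; 0; 1; 2] == 1)).
- rewrite uses_cat uses_map_inl uses_notin // last_map lasts inE negb_or.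
  apply/andP; split; first by rewrite (inj_eq (@inl_inj _ _)) ad.
  by apply/negP=> /mapP[].
- rewrite uses_cat uses_map_inl uses_notin // last_map lasts inE negb_or.
  apply/andP; split; first by rewrite (inj_eq (@inl_inj _ _)) cd.
  by apply/negP=> /mapP[].
Qed.

(** The whole block is traversed from 0 to 7, then the old path is followed from [b] to [c]. *)
Lemma extension_bc : spanning_path (inl a : G') (inr (inord 0)) (inl c) (inr (inord 2))
  (inr (inord 0)) (inl c).
Proof.
have [s [pbs lasts cnts nab ncd]] := ext_bc ext.
have := ext_uniq ext; rewrite /= !inE !negb_or.
move=> /and4P[/and3P[/negbTE ab _ _] /andP[/negbTE bc _] _ _].
pose L := [:: 1; 2; 3; 4; 5; 6; 7].
have bp : block_path 1 7 L by [].
have usesL x y : uses (inl x : G') (inr (inord y)) (inr (inord 0)) (block_seq L) = 0.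
  by rewrite uses_notin // inE /=; apply/negP=> /mapP[].
exists (block_seq L ++ inl b :: map inl s); split.
- rewrite (block_seq_path _ _ bp); apply/andP; split; first by rewrite /= !inordK.
  rewrite [path _ _ _]/= lift_path // andbT.
  by case: (@block_adj b 7 isT erefl).
- by rewrite last_cat /= last_map lasts.
- move=> [u|q]; rewrite -cat_cons -[inr _ :: _]/(block_seq (0 :: L)) count_cat -[inl b ::
  _]/(map inl (b :: s)).
    by rewrite count_map_inl cnts count_block_seq_inl.
  rewrite count_map_inl_inr count_block_seq // addn0.
  exact/eqP/(forall8 (P := fun q => count_mem q (0 :: L) == 1)).
- by rewrite uses_cat usesL (last_block_seq _ bp) /= uses_map_inl !(inj_eq (@inl_inj _ _)) [b ==
  a]eq_sym ab andbF.
- by rewrite uses_cat usesL (last_block_seq _ bp) /= uses_map_inl !(inj_eq (@inl_inj _ _)) bc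
  andbF.
Qed.

(* If both marked edges are used, the block is split into two paths; otherwise the path which
   uses one of them makes a detour through the whole block, and the second list is idle. *)
Lemma extension_vdel_inl v : exists u s, [/\ path (@adj G') u s,
  forall y, count_mem y (u :: s) = (y != inl v) &
  0 < uses (inl a : G') (inr (inord 0)) u s + uses (inl c) (inr (inord 2)) u s].
Proof.
have [u [s [us cnt used]]] := ext_vdel ext v.
have uniq_us : uniq (u :: s).
  by apply: count_mem_uniq => y; rewrite -has_pred1 has_count cnt; case: (y != v).
have [PE [PF [hPE hPE' hPF hPF' cov]]] : exists PE PF, [/\ block_path 0 7 PE,
    block_path 7 0 (rev PE), block_path 2 5 PF, block_path 5 2 (rev PF) &
    forall q : 'I_8, uses a b u s * count_mem (val q) PE + uses c d u s * count_mem (val q) PF =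
      1].
  move: (uses_le1 a b uniq_us) (uses_le1 c d uniq_us) used.
  case: (uses a b u s) (uses c d u s) => [|[|//]] [|[|//]] // _ _ _.
  - exists [:: 0; 1; 2; 3; 4; 5; 6; 7], [:: 2; 1; 0; 4; 3; 7; 6; 5]; split=> // q.
    exact/eqP/(forall8 (P := fun q => 0 * count_mem q [:: 0; 1; 2; 3; 4; 5; 6;
      7] + 1 * count_mem q [:: 2; 1; 0; 4; 3; 7; 6; 5] == 1)).
  - exists [:: 0; 1; 2; 3; 4; 5; 6; 7], [:: 2; 1; 0; 4; 3; 7; 6; 5]; split=> // q.
    exact/eqP/(forall8 (P := fun q => 1 * count_mem q [:: 0; 1; 2; 3; 4; 5; 6;
      7] + 0 * count_mem q [:: 2; 1; 0; 4; 3; 7; 6; 5] == 1)).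
  - exists [:: 0; 1; 6; 7], [:: 2; 3; 4; 5]; split=> // q.
    exact/eqP/(forall8 (P := fun q => 1 * count_mem q [:: 0; 1; 6; 7] + 1 * count_mem q [:: 2;
      3; 4; 5] == 1)).
exists (inl u), (expand PE PF u s); split.
- exact: expand_path.
- move=> [w|q] /=.
    by rewrite expand_count_inl !(inj_eq (@inl_inj _ _)) -cnt.
  by rewrite add0n (expand_count_inr hPE hPE' hPF hPF') cov.
- by apply: leq_trans used _; rewrite leq_add ?expand_uses_ab ?expand_uses_cd.
Qed.

(** The path runs along [L] to 0, takes the marked edge to [a], follows the old path to [d] and,
    unless [R] is empty, re-enters the block at 5. The default 8 is never read. *)
Lemma extension_vdel_ad (q : 'I_8) z (L R : seq nat) :
  block_path z 0 L -> (if R is _ :: _ then block_path 5 (last 8 R) R else true) ->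
  (forall p : 'I_8, count_mem (val p) (L ++ R) = (p != q)) ->
  exists u s, [/\ path (@adj G') u s, forall y, count_mem y (u :: s) = (y != inr q) &
  0 < uses (inl a : G') (inr (inord 0)) u s + uses (inl c) (inr (inord 2)) u s].
Proof.
case: L => // i L hL hR cov; have [s [pas lasts cnts nab ncd]] := ext_ad ext.
have /and4P[_ /eqP iz _ /eqP lastL] := hL.
have L8 : all (ltn^~ 8) (i :: L) := block_path8 hL.
have R8 : all (ltn^~ 8) R by case: R hR {cov} => // j R /block_path8.
have [a0 a0'] := @block_adj a 0 isT erefl; have [d5 _] := @block_adj d 5 isT erefl.
exists (inr (inord i)), (block_seq L ++ inl a :: map inl s ++ block_seq R); split.
- rewrite cat_path (block_seq_behead hL) last_map lastL andTb [path _ _ (inl a :: _)]/=.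
  apply/andP; split; first exact: a0'.
  rewrite cat_path lift_path // last_map lasts.
  case: R hR {cov R8} => // j R hR.
  by rewrite -[block_seq _]cats0 (block_seq_path _ _ hR) d5.
- move=> y; rewrite -cat_cons -[inr _ :: _]/(block_seq (i :: L)) -cat_cons -[inl a :: _]/(map
  inl (a :: s)).
  rewrite !count_cat; case: y => [u|p].
    by rewrite !count_block_seq_inl count_map_inl cnts.
  rewrite count_map_inl_inr !count_block_seq // add0n -count_cat cov.
  by rewrite (inj_eq (@inr_inj _ _)).
- by rewrite uses_cat last_map lastL /= !eqxx /=; lia.
Qed.

(** The old path from [b] to [c] continues over the marked edge to 2 and along [L]. *)
Lemma extension_vdel_bc (q : 'I_8) (L : seq nat) :
  block_path 2 (last 8 L) L -> (forall p : 'I_8, count_mem (val p) L = (p != q)) ->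
  exists u s, [/\ path (@adj G') u s, forall y, count_mem y (u :: s) = (y != inr q) &
  0 < uses (inl a : G') (inr (inord 0)) u s + uses (inl c) (inr (inord 2)) u s].
Proof.
move=> hL cov; have [s [pbs lasts cnts nab ncd]] := ext_bc ext.
have [c2 _] := @block_adj c 2 isT erefl.
exists (inl b), (map inl s ++ block_seq L); split.
- rewrite cat_path lift_path // last_map lasts.
  by rewrite -[block_seq _]cats0 (block_seq_path _ _ hL) c2.
- move=> y; rewrite -cat_cons -[inl b :: _]/(map inl (b :: s)) count_cat; case: y => [u|p].
    by rewrite count_block_seq_inl count_map_inl cnts.
  rewrite count_map_inl_inr count_block_seq ?(block_path8 hL) // add0n cov.
  by rewrite (inj_eq (@inr_inj _ _)).
- rewrite !uses_cat !last_map lasts; case: L hL {cov} => // i L /and4P[_ /eqP-> _ _] /=.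
  by rewrite !eqxx /=; lia.
Qed.

Lemma extension_vdel_inr (q : 'I_8) : exists u s, [/\ path (@adj G') u s,
  forall y, count_mem y (u :: s) = (y != inr q) &
  0 < uses (inl a : G') (inr (inord 0)) u s + uses (inl c) (inr (inord 2)) u s].
Proof.
have cov k L (k8 : k < 8) : all (fun p => count_mem p L == (p != k)) (iota 0 8) ->
    forall p : 'I_8, count_mem (val p) L = (p != Ordinal k8).
  by move=> h p; apply/eqP; apply: (forall8 (P := fun p => count_mem p L == (p != k))).
case: q => [[|[|[|[|[|[|[|[|]]]]]]]] ] // q8.
(* The lists cover the block without [q]; for [q = 6] there are two pieces, with the old path
   between them. *)
- by apply: (@extension_vdel_bc _ [:: 2; 1; 6; 7; 3; 4; 5]) => //; apply: cov.
- by apply: (@extension_vdel_ad _ 2 [:: 2; 3; 7; 6; 5; 4; 0] [::]) => //; apply: cov.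
- by apply: (@extension_vdel_ad _ 7 [:: 7; 3; 4; 5; 6; 1; 0] [::]) => //; apply: cov.
- by apply: (@extension_vdel_bc _ [:: 2; 1; 0; 4; 5; 6; 7]) => //; apply: cov.
- by apply: (@extension_vdel_ad _ 5 [:: 5; 6; 7; 3; 2; 1; 0] [::]) => //; apply: cov.
- by apply: (@extension_vdel_ad _ 7 [:: 7; 6; 1; 2; 3; 4; 0] [::]) => //; apply: cov.
- by apply: (@extension_vdel_ad _ 7 [:: 7; 3; 2; 1; 0] [:: 5; 4]) => //; apply: cov.
- by apply: (@extension_vdel_ad _ 6 [:: 6; 5; 4; 3; 2; 1; 0] [::]) => //; apply: cov.
Qed.

Theorem extension_extendable :
  extendable (inl a : G') (inr (inord 0)) (inl c) (inr (inord 2)).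
Proof.
have [a0 _] := @block_adj a 0 isT erefl; have [c2 _] := @block_adj c 2 isT erefl.
have := ext_uniq ext; rewrite /= !inE !negb_or => /and4P[/and3P[_ ac _] _ _ _].
split=> //.
- exact: extension_cubic.
- by rewrite /= !inE !(inj_eq (@inl_inj _ _)) !(inj_eq (@inr_inj _ _)) (negbTE ac) -val_eqE /=
  !inordK.
- exact: extension_C3.
- exact: extension_C4.
- exact: extension_e4c.
- exact: extension_n3.
- exact: extension_4.
- by move=> [v|q]; [apply: extension_vdel_inl | apply: extension_vdel_inr].
- exact: extension_ad.
- exact: extension_bc.
Qed.

Lemma extension_order : #|G'| = #|G| + 8.
Proof. by rewrite card_sum card_ord. Qed.

End ExtensionPaths.

(** * Base graphs *)

Definition well_formed (m : nat) (L : seq (seq nat)) : bool :=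
  (size L == m.+1) && every (fun x => let r := row L x in
    [&& size r == 3, uniq r & every (fun y => [&& y < m.+1, y != x & occurs x (row L y)]) r])
  (iota 0 m.+1).

Definition no_short_cycle (m : nat) (L : seq (seq nat)) : bool :=
  every (fun x => every (fun y => every (fun z =>
      if eqn z x then true else
      if occurs x (row L z) then false else
      every (fun w => if eqn w y then true else ~~ occurs x (row L w)) (row L z))
    (row L y)) (row L x)) (iota 0 m.+1).

(* [sides] are the sides of the vertices from [k] on, [c] is the number of cut edges among them. *)
Fixpoint cut_search (L : seq (seq nat)) k (sides : seq bool) c : bool :=
  if k is k'.+1 then
    every (fun b =>
      let c' := c + count (fun j => (k' < j) && (nth b sides (j - k) != b)) (row L k') in
      if 3 < c' then true else cut_search L k' (b :: sides) c') [:: true; false]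
  else (count id sides <= 1) || (count negb sides <= 1).

(** Ordered by the larger end, so that edges among the first vertices are coloured first and clashes
    show early. *)
Definition edge_list (m : nat) (L : seq (seq nat)) : seq (nat * nat) :=
  flatten [seq [seq (x, y) | x <- row L y & x < y] | y <- iota 0 m.+1].

Definition clash (e : nat * nat) (c : nat) (a : nat * nat * nat) : bool :=
  if eqn c a.2 then [|| eqn e.1 a.1.1, eqn e.1 a.1.2, eqn e.2 a.1.1 | eqn e.2 a.1.2] else false.

Fixpoint color_search (es : seq (nat * nat)) (acc : seq (nat * nat * nat)) : bool :=
  if es is e :: es' then
    any (fun c => if any (clash e c) acc then false else color_search es' ((e, c) :: acc)) (iota
      0 3)
  else true.

(* The edges of the path 0, 1, ..., m alternate between two colours.  Every vertex lies on one
   other edge, except that 0 and m lie on two; giving the fourth colour to the marked edges at 0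
   and m makes all other edges disjoint. *)
Definition path_color (m b c x y : nat) : nat :=
  if eqn x.+1 y then nat_of_bool (odd x) else if eqn y.+1 x then nat_of_bool (odd y)
  else if (minn x y, maxn x y) \in [:: (0, b); (c, m)] then 3 else 2.

Definition color_ok (m : nat) (L : seq (seq nat)) b c : bool :=
  every (fun x => every (fun y =>
      (path_color m b c x y == path_color m b c y x) && (path_color m b c x y < 4) &&
      every (fun z => (z == y) || (path_color m b c x y != path_color m b c x z)) (row L x))
    (row L x)) (iota 0 m.+1).

(** Without [v] there are [m] vertices, so a spanning path has [m.-1] steps. *)
Definition vdel_search (m : nat) (L : seq (seq nat)) b c v : bool :=
  any (fun s => if eqn s v then false else
    walk L (fun _ w => ~~ eqn w v)
      (fun y q => 0 < uses 0 b y q + uses c m y q) m.-1 s [::]) (iota 0 m.+1).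

(* The walk runs from [z] back to [x]. *)
Definition span_search (m : nat) (L : seq (seq nat)) b c x z : bool :=
  walk L (fun i j => uses 0 b i [:: j] + uses c m i [:: j] == 0)
    (fun y q => [&& y == x, uses 0 b y q == 0 & uses c m y q == 0]) m z [::].

Definition extendable_check (m : nat) (L : seq (seq nat)) b c : bool :=
  [&& well_formed m L, uniq [:: 0; b; c; m], occurs b (row L 0), occurs m (row L c),
      no_short_cycle m L, cut_search L m.+1 [::] 0,
      uniq (edge_list m L), ~~ color_search (edge_list m L) [::], color_ok m L b c,
      every (vdel_search m L b c) (iota 0 m.+1),
      span_search m L b c 0 m & span_search m L b c b c].

(** * Soundness of the checks on base graphs *)

Lemma color_searchP (f : nat * nat -> nat) es done :
  {in es, forall e, f e < 3} -> uniq (es ++ done) ->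
  {in es ++ done &, forall e e', e != e' ->
    [|| e.1 == e'.1, e.1 == e'.2, e.2 == e'.1 | e.2 == e'.2] -> f e != f e'} ->
  color_search es [seq (e, f e) | e <- done].
Proof.
elim: es done => // e es IH done f3; rewrite cat_cons cons_uniq => /andP[ne un] fP.
suff : has (fun c => if any (clash e c) [seq (e, f e) | e <- done] then false
    else color_search es ((e, c) :: [seq (e, f e) | e <- done])) (iota 0 3) by rewrite -anyE.
(* The search succeeds on the branch that follows [f]. *)
apply/hasP; exists (f e); first by rewrite mem_iota f3 ?mem_head.
rewrite anyE; case: hasP => [[_ /mapP[e' e'd ->]]|_].
  rewrite /clash /=; case: eqnP => // fe sh.
  have : f e != f e'.
    apply: fP => //; rewrite ?mem_head ?inE ?mem_cat ?e'd ?orbT //.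
    by apply: contraNneq ne => ->; rewrite mem_cat e'd orbT.
  by rewrite fe eqxx.
rewrite -[(e, f e) :: _]/([seq (e, f e) | e <- e :: done]); apply: IH.
  by move=> x xs; apply: f3; rewrite inE xs orbT.
  by rewrite -cat1s uniq_catCA /= ne un.
have sub : {subset es ++ e :: done <= e :: es ++ done}.
  by move=> z; rewrite mem_cat !inE mem_cat => /or3P[]->; rewrite ?orbT.
by move=> x y /sub xs /sub ys; apply: fP.
Qed.

Section Rows.
Variables (m : nat) (L : seq (seq nat)).
Hypothesis wf : well_formed m L.

Lemma wf_row x : x < m.+1 -> size (row L x) = 3 /\ uniq (row L x).
Proof.
move=> xm; have /andP[_] := wf; rewrite everyE => /allP/(_ x).
by rewrite mem_iota /= => /(_ xm)/and3P[/eqP].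
Qed.

Lemma wf_mem x y : y \in row L x -> [/\ x < m.+1, y < m.+1, y != x & x \in row L y].
Proof.
move=> xy; have /andP[/eqP sz] := wf; have := mem_row xy; rewrite sz => xm.
rewrite everyE => /allP/(_ x); rewrite mem_iota /= => /(_ xm)/and3P[_ _].
by rewrite everyE => /allP/(_ y xy); rewrite occursE => /and3P[].
Qed.

Definition row_rel : rel 'I_m.+1 := fun x y => val y \in row L x.

Lemma row_sym : symmetric row_rel.
Proof. by move=> x y; apply/idP/idP=> /wf_mem[]. Qed.

Lemma row_irrefl : irreflexive row_rel.
Proof. by move=> x; apply/negP=> /wf_mem[]; rewrite eqxx. Qed.

Definition row_graph : sgraph := SGraph row_sym row_irrefl.

Lemma count_row (P : pred nat) (x : row_graph) :
  count P (row L x) = \sum_(y : row_graph) (adj x y && P y).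
Proof.
have [_ ux] := wf_row (ltn_ord x).
transitivity (count (fun y => (y \in row L x) && P y) (iota 0 m.+1)).
  rewrite -!size_filter; apply/perm_size/uniq_perm; rewrite ?filter_uniq ?iota_uniq //.
  move=> y; rewrite !mem_filter mem_iota /= andbC [_ && P y]andbC andbAC -andbA.
  by case: (boolP (y \in row L x)) => [/wf_mem[_ ->]|]; rewrite ?andbF ?andbT.
rewrite -sum1_count big_mkcond -[iota 0 m.+1]/(index_iota 0 m.+1) big_mkord.
by apply: eq_bigr => y _; rewrite /= /row_rel; case: (_ && _).
Qed.

Lemma row_cubic : cubic row_graph.
Proof.
move=> x; rewrite cubic_sum; have [<- _] := wf_row (ltn_ord x).
rewrite -count_predT count_row; by under [RHS]eq_bigr do rewrite andbT.
Qed.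

Lemma row_C34 : no_short_cycle m L ->
  (forall x y z : row_graph, adj x y -> adj y z -> ~~ adj z x) /\
  (forall x y z w : row_graph,
    adj x y -> adj y z -> adj z w -> adj w x -> x != z -> y = w).
Proof.
move=> h.
have {}h (x y z : row_graph) : adj x y -> adj y z -> z != x ->
    ~~ adj z x /\ (forall w : row_graph, adj z w -> w != y -> ~~ adj w x).
  move=> xy yz zx; move: h; rewrite /no_short_cycle everyE => /allP/(_ x).
  rewrite mem_iota ltn_ord => /(_ isT); rewrite everyE => /allP/(_ y xy).
  rewrite everyE => /allP/(_ z yz); rewrite (_ : eqn z x = (z == x)) // (negbTE zx).
  rewrite occursE; case: ifPn => // zx' h; split=> // w zw wy.
  move: h; rewrite everyE => /allP/(_ w zw).
  by rewrite (_ : eqn w y = (w == y)) // (negbTE wy) occursE.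
split=> [x y z xy yz|x y z w xy yz zw wx xz].
  have [->|zx] := eqVneq z x; first by rewrite adj_irrefl.
  by have [] := h x y z xy yz zx.
rewrite eq_sym in xz; have [_ /(_ w zw)] := h x y z xy yz xz.
by case: (eqVneq w y) => [->//|_ /(_ isT)]; rewrite wx.
Qed.

Section Cut.
Variable t : nat -> bool.

(** A cut edge is counted at its smaller end, which is where [cut_search], running downwards, meets
    it. *)
Definition cut_count k : nat :=
  \sum_(k <= i < m.+1) count (fun j => (i < j) && (t j != t i)) (row L i).

Lemma cut_searchP k : k <= m.+1 ->
  cut_search L k [seq t i | i <- iota k (m.+1 - k)] (cut_count k) ->
  [|| 3 < cut_count 0, count t (iota 0 m.+1) <= 1 | count (predC t) (iota 0 m.+1) <= 1].
Proof.
elim: k => [|k IH] km.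
  rewrite subn0 => h; apply/orP; right; move: h.
  by rewrite -[cut_search _ _ _ _]/((count id _ <= 1) || (count negb _ <= 1)) !count_map.
set sides := [seq t i | i <- _]; set c := cut_count _.
pose F b := let c' := c + count (fun j => (k < j) && (nth b sides (j - k.+1) != b)) (row L k) in
  if 3 < c' then true else cut_search L k (b :: sides) c'.
(* Both sides were tried for vertex [k], in particular the one prescribed by [t]. *)
move=> h; have {h} : F (t k).
  have : every F [:: true; false] := h.
  by rewrite everyE => /allP; apply; case: (t k).
rewrite /F {F} /= /sides.
have -> : count (fun j => (k < j) && (nth (t k) [seq t i | i <- iota k.+1 (m.+1 - k.+1)] (j -
  k.+1) != t k)) (row L k)
    = count (fun j => (k < j) && (t j != t k)) (row L k).
  apply: eq_in_count => j /wf_mem[_ jm _ _]; case: ltnP => //= kj.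
  have jk : j - k.+1 < m.+1 - k.+1 by lia.
  by rewrite (nth_map 0) ?size_iota // nth_iota // subnKC.
rewrite addnC -big_ltn // -/(cut_count k).
(* A branch abandoned with more than 3 cut edges is settled, as further vertices only add to the
   count. *)
case: ltnP => [k3 _|_].
  apply/orP; left; apply: leq_trans k3 _; rewrite /cut_count.
  by rewrite [leqRHS](big_cat_nat (n := k)) ?(ltnW km) //= leq_addl.
rewrite -[t k :: _]/([seq t i | i <- k :: iota k.+1 (m.+1 - k.+1)]).
by rewrite -[k :: _]/(iota k (m.+1 - k.+1).+1) -subSn // => /IH; apply; apply: ltnW.
Qed.
End Cut.

Lemma row_e4c : cut_search L m.+1 [::] 0 -> essentially_4_edge_connected row_graph.
Proof.
move=> h S S1 S1'; pose t i := (inord i : row_graph) \in S.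
have tE (x : row_graph) : t x = (x \in S) by rewrite /t inord_val.
have cardE (A : {set row_graph}) (p : pred nat) : (forall x : row_graph, p x = (x \in A)) ->
    count p (iota 0 m.+1) = #|A|.
  move=> pA; rewrite -sum1_count big_mkcond -[iota 0 m.+1]/(index_iota 0 m.+1) big_mkord
    -sum1_card [RHS]big_mkcond.
  by apply: eq_bigr => x _; rewrite pA.
have := @cut_searchP t m.+1 (leqnn _).
rewrite subnn /cut_count big_geq // => /(_ h)/or3P[||]; last 2 first.
- by rewrite (cardE S) // leqNgt S1.
- by rewrite (cardE (~: S)) => [|x]; rewrite ?inE /= ?tE // leqNgt S1'.
have -> : \sum_(0 <= i < m.+1) count (fun j => (i < j) && (t j != t i)) (row L i) =
    \sum_(x : row_graph) \sum_(y : row_graph) (adj x y && ((x < y) && (t y != t x))).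
  by rewrite big_mkord; apply: eq_bigr => x _; apply: count_row.
(* The search counts a cut edge from its smaller end, [boundary] from its end in [S]; splitting by
   the order of the ends reconciles the two. *)
rewrite (_ : boundary S = \sum_(x : row_graph) \sum_(y : row_graph)
    [&& adj x y && (x < y), x \in S & y \notin S] +
   \sum_(x : row_graph) \sum_(y : row_graph) [&& adj x y && (y < x), x \in S & y \notin S]).
  rewrite [X in _ + X]exchange_big -big_split; congr (_ < _); apply: eq_bigr => x _ /=.
  rewrite -big_split; apply: eq_bigr => y _ /=; rewrite !tE [row_rel y x]row_sym.
  by case: (row_rel x y) (x < y) (x \in S) (y \in S) => [] [] [] [].
rewrite -big_split; apply: eq_bigr => x _ /=; rewrite -big_split; apply: eq_bigr => y _ /=.
case: (ltngtP x y) => [||/val_inj->]; rewrite ?andbT ?andbF ?addn0 //=.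
by rewrite row_irrefl.
Qed.

Lemma row_n3 : uniq (edge_list m L) -> ~~ color_search (edge_list m L) [::] -> ~ k_colorable
  row_graph 3.
Proof.
move=> ues ncs [f fS fP]; case/negP: ncs.
pose vt i : row_graph := inord i.
have esP e : e \in edge_list m L -> e.1 < e.2 /\ adj (vt e.1) (vt e.2).
  case/flatten_mapP=> y _ /mapP[x]; rewrite mem_filter => /andP[xy yx] -> /=; split=> //.
  by have [y_m x_m _ xy'] := wf_mem yx; rewrite /row_rel /vt /= !inordK.
have vt_inj x y : x < m.+1 -> y < m.+1 -> x != y -> vt x != vt y.
  by move=> xm ym; rewrite -val_eqE /vt /= !inordK.
have lt_m e : e \in edge_list m L -> e.1 < m.+1 /\ e.2 < m.+1.
  by case/flatten_mapP=> y _ /mapP[x]; rewrite mem_filter => /andP[_ /wf_mem[]] ? ? _ _ ->.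
apply: (@color_searchP (fun e => f (vt e.1) (vt e.2)) _ [::]).
- by move=> e /esP[_ /fS[]].
- by rewrite cats0.
rewrite cats0 => -[x y] [z w] e e'; have [xm ym] := lt_m _ e; have [zm wm] := lt_m _ e'.
have [/= xy axy] := esP _ e; have [/= zw azw] := esP _ e'.
have [Sxy _] := fS _ _ axy; have [Szw _] := fS _ _ azw.
move=> ne /or4P[]/eqP E; move: ne; rewrite E in xy axy Sxy xm ym *.
- by rewrite xpair_eqE eqxx /= => yw; apply: fP => //; apply: vt_inj.
- by move=> _; rewrite Szw; apply: fP; rewrite // 1?adj_sym //; apply: vt_inj => //;
  rewrite neq_ltn (ltn_trans zw) ?orbT.
- by move=> _; rewrite Sxy; apply: fP; rewrite // 1?adj_sym //; apply: vt_inj => //;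
  rewrite neq_ltn (ltn_trans xy).
- rewrite xpair_eqE eqxx andbT => xz; rewrite Sxy Szw; apply: fP; rewrite 1?adj_sym //;
  exact: vt_inj.
Qed.

Lemma row_4 b c : color_ok m L b c -> k_colorable row_graph 4.
Proof.
rewrite /color_ok everyE => /allP h.
have {}h (x y : row_graph) : adj x y ->
    [/\ path_color m b c x y = path_color m b c y x, path_color m b c x y < 4 &
       forall z : row_graph, adj x z -> z != y -> path_color m b c x y != path_color m b c x z].
  move=> xy; have := h x; rewrite mem_iota ltn_ord => /(_ isT); rewrite everyE => /allP/(_ y xy).
  rewrite everyE => /andP[/andP[/eqP ? ?] /allP hz]; split=> // z xz zy.
  by have /orP[/eqP/val_inj E|//] := hz z xz; rewrite E eqxx in zy.
exists (fun x y : row_graph => path_color m b c x y) => [x y /h[]//|x y z xy xz yz].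
by have [_ _] := h x y xy; apply; rewrite // eq_sym.
Qed.

Notation vt := (fun i => inord i : row_graph).

Lemma row_uses x y u s : all (ltn^~ m.+1) [:: x, y, u & s] ->
  uses (vt x) (vt y) (vt u) (map vt s) = uses x y u s.
Proof.
case/and3P=> xm ym; elim: s u => //= v s IH u /and3P[um vm sm].
rewrite IH /= ?vm //; congr (nat_of_bool (_ && _ || _ && _) + _);
  by rewrite -val_eqE /= !inordK.
Qed.

Lemma row_walk (ok : rel nat) (y : nat) q :
  path (fun i j => (i \in row L j) && ok j i) y q -> y < m.+1 ->
  all (ltn^~ m.+1) (y :: q) /\ path (@adj row_graph) (vt y) (map vt q).
Proof.
elim: q y => [|z q IH] y /=; first by move=> _ ->.
move=> /andP[/andP[yz _] /IH h] ym; have [zm _ _ zy] := wf_mem yz.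
have [zq pq] := h zm; split; first by rewrite ym.
by rewrite pq andbT /row_rel /= !inordK.
Qed.

Lemma row_uniq q : all (ltn^~ m.+1) q -> uniq q -> uniq (map vt q).
Proof.
move=> /allP qm uq; rewrite map_inj_in_uniq // => i j /qm im /qm jm /(congr1 val) /=.
by rewrite !inordK.
Qed.

Lemma uniq_count (q : seq row_graph) x : uniq q -> size q = m.+1 -> count_mem x q = 1.
Proof.
move=> uq sq; rewrite count_uniq_mem //.
have [||_ ->] := uniq_min_size uq (s2 := enum row_graph).
- by move=> z; rewrite mem_enum.
- by rewrite sq size_enum_ord.
by rewrite mem_enum.
Qed.

Lemma row_span b c x z : b < m.+1 -> c < m.+1 -> z < m.+1 -> span_search m L b c x z ->
  spanning_path (vt 0) (vt b) (vt c) (vt m) (vt x) (vt z).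
Proof.
move=> bm cm zm /walkP[] // y [q [/and3P[/eqP-> /eqP ab0 /eqP cd0] uq pq lq sq]].
have xm : x < m.+1.
  by case: q pq lq {uq sq ab0 cd0} => [_ /= ->//|w q /andP[/andP[/wf_mem[]]]].
have [qm pq'] := row_walk pq xm.
exists (map vt q); split=> //.
- by rewrite last_map lq.
- by move=> w; apply: (@uniq_count (map vt (x :: q))); rewrite ?row_uniq // size_map /= sq addn0.
- by rewrite row_uses //= bm.
- by rewrite row_uses //= cm ltnSn.
Qed.

Lemma row_vdel b c : b < m.+1 -> c < m.+1 -> 0 < m ->
  every (vdel_search m L b c) (iota 0 m.+1) ->
  forall v : row_graph, exists u s, [/\ path (@adj row_graph) u s,
    forall y, count_mem y (u :: s) = (y != v) &
    0 < uses (vt 0) (vt b) u s + uses (vt c) (vt m) u s].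
Proof.
move=> bm cm m0; rewrite everyE => /allP h v; have := h v; rewrite mem_iota ltn_ord => /(_ isT).
rewrite /vdel_search anyE => /hasP[s]; rewrite mem_iota /= => sm.
case: eqnP => // /eqP sv /walkP[] // y [q [used uq pq lq sq]].
have {lq}[yv [vq ym]] : y != v /\ val v \notin q /\ y < m.+1.
  elim: q y pq lq {uq sq used} => [|w q IH] y /=; first by move=> _ ->; split.
  move=> /andP[/andP[/wf_mem[_ ym _ _] yv] /IH{}IH] /IH[wv [vq _]].
  by split=> //; rewrite inE negb_or [_ == w]eq_sym wv vq.
have [qm pq'] := row_walk pq ym.
exists (vt y), (map vt q); split=> //.
- have vnq : v \notin map vt (y :: q).
    apply/mapP=> -[i iq]; have im : i < m.+1 := allP qm i iq.
    move/(congr1 val); rewrite /= inordK // => vi.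
    by move: iq; rewrite -vi inE (negbTE vq) orbF eq_sym (negbTE yv).
  (* Together with [v] the path lists [m.+1] distinct vertices, hence all of them. *)
  move=> w; have := @uniq_count (v :: map vt (y :: q)) w.
  rewrite cons_uniq vnq row_uniq // -[size _]/(size (map vt (y :: q))).+1 size_map /= sq addn0
    prednK //.
  move=> /(_ isT erefl); rewrite [w == v]eq_sym -/(count_mem w (vt y :: map vt q)).
  by case: (v == w); rewrite ?add0n // add1n => -[].
by rewrite !row_uses //= ?bm ?cm ?ltnSn.
Qed.

Lemma check_extendable b c : extendable_check m L b c ->
  extendable (vt 0) (vt b) (vt c) (vt m).
Proof.
case/and5P=> _ u4; rewrite !occursE => b0 cm /and5P[short cut ues ncol /and4P[col vdel ad bc]].
have [_ bm _ _] := wf_mem b0; have [c_m _ _ _] := wf_mem cm.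
have [C3 C4] := row_C34 short.
have m0 : 0 < m by rewrite lt0n; apply: contraTneq u4 => ->; rewrite /= !inE eqxx !orbT.
have adj_vt x y : y \in row L x -> @adj row_graph (vt x) (vt y).
  by move=> xy; have [xm ym _ _] := wf_mem xy; rewrite /= /row_rel /= !inordK.
split=> //.
- exact: row_cubic.
- rewrite (@row_uniq [:: 0; b; c; m]) //= bm c_m ltnSn //.
- exact: adj_vt.
- exact: adj_vt.
- exact: row_e4c.
- exact: row_n3.
- exact: row_4 col.
- exact: row_vdel.
- exact: row_span.
- exact: row_span.
Qed.
End Rows.

(** * The orders attained *)

Definition has_extendable (n : nat) : Prop :=
  exists (G : sgraph) (a b c d : G), extendable a b c d /\ #|G| = n.

Lemma has_extendable_check m L b c : extendable_check m L b c -> has_extendable m.+1.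
Proof.
move=> h; have /and3P[wf _ _] := h.
exists (row_graph wf), (inord 0), (inord b), (inord c), (inord m).
by split; [exact: check_extendable | rewrite card_ord].
Qed.

Lemma has_extendable8 n : has_extendable n -> has_extendable (n + 8).
Proof.
move=> [G [a [b [c [d [E <-]]]]]].
exists (extension a b c d), (inl a), (inr (inord 0)), (inl c), (inr (inord 2)).
by split; [exact: extension_extendable | exact: extension_order].
Qed.

(* The vertices are numbered along a spanning path which avoids the two marked edges, one at
   each of its ends. *)
Definition petersen : seq (seq nat) :=
  [:: [:: 1; 4; 7]; [:: 0; 2; 9]; [:: 1; 3; 6]; [:: 2; 4; 8]; [:: 0; 3; 5]; [:: 4; 6; 9];
      [:: 2; 5; 7]; [:: 0; 6; 8]; [:: 3; 7; 9]; [:: 1; 5; 8]].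

(* The flower snark J5. *)
Definition flower_snark : seq (seq nat) :=
  [:: [:: 1; 4; 12]; [:: 0; 2; 19]; [:: 1; 3; 16]; [:: 2; 4; 8]; [:: 0; 3; 5]; [:: 4; 6; 10];
      [:: 5; 7; 13]; [:: 6; 8; 17]; [:: 3; 7; 9]; [:: 8; 10; 15]; [:: 5; 9; 11];
      [:: 10; 12; 18]; [:: 0; 11; 13]; [:: 6; 12; 14]; [:: 13; 15; 19]; [:: 9; 14; 16];
      [:: 2; 15; 17]; [:: 7; 16; 18]; [:: 11; 17; 19]; [:: 1; 14; 18]].

(* A Loupekine snark: three copies of the Petersen graph minus a path on three vertices,
   arranged in a ring and joined to a new vertex. *)
Definition loupekine22 : seq (seq nat) :=
  [:: [:: 1; 4; 14]; [:: 0; 2; 6]; [:: 1; 3; 20]; [:: 2; 4; 10]; [:: 0; 3; 5]; [:: 4; 6; 17];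
      [:: 1; 5; 7]; [:: 6; 8; 12]; [:: 7; 9; 18]; [:: 8; 10; 13]; [:: 3; 9; 11];
      [:: 10; 12; 21]; [:: 7; 11; 13]; [:: 9; 12; 14]; [:: 0; 13; 15]; [:: 14; 16; 19];
      [:: 15; 17; 21]; [:: 5; 16; 18]; [:: 8; 17; 19]; [:: 15; 18; 20]; [:: 2; 19; 21];
      [:: 11; 16; 20]].

(* [loupekine22] with two edges subdivided and the two new vertices joined. *)
Definition insertion24 : seq (seq nat) :=
  [:: [:: 1; 5; 10]; [:: 0; 2; 18]; [:: 1; 3; 6]; [:: 2; 4; 13]; [:: 3; 5; 22]; [:: 0; 4; 6];
      [:: 2; 5; 7]; [:: 6; 8; 20]; [:: 7; 9; 12]; [:: 8; 10; 14]; [:: 0; 9; 11];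
      [:: 10; 12; 16]; [:: 8; 11; 13]; [:: 3; 12; 14]; [:: 9; 13; 15]; [:: 14; 16; 23];
      [:: 11; 15; 17]; [:: 16; 18; 21]; [:: 1; 17; 19]; [:: 18; 20; 23]; [:: 7; 19; 21];
      [:: 17; 20; 22]; [:: 4; 21; 23]; [:: 15; 19; 22]].

Lemma has_extendable10 : has_extendable 10.
Proof. by apply: (@has_extendable_check 9 petersen 7 5); vm_compute. Qed.

Lemma has_extendable20 : has_extendable 20.
Proof. by apply: (@has_extendable_check 19 flower_snark 4 1); vm_compute. Qed.

Lemma has_extendable22 : has_extendable 22.
Proof. by apply: (@has_extendable_check 21 loupekine22 4 11); vm_compute. Qed.

Lemma has_extendable24 : has_extendable 24.
Proof. by apply: (@has_extendable_check 23 insertion24 10 15); vm_compute. Qed.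

(** The order 18 comes from 10, the orders 20, 22 and 24 are base cases, and from 26 on subtracting
    8 leaves an even number that is at least 18. *)
Lemma even_extendable n : ~~ odd n -> 18 <= n -> has_extendable n.
Proof.
elim/ltn_ind: n => n IH n_even; rewrite leq_eqVlt => /predU1P[<-|n18].
  exact: has_extendable8 has_extendable10.
case: (ltnP n 26) => [n26|n26].
  have : n \in [:: 20; 22; 24].
    by rewrite !inE; move: n n_even n18 n26 {IH}; do 26?[case=> //].
  rewrite !inE => /or3P[]/eqP->; [exact: has_extendable20 | exact: has_extendable22 |].
  exact: has_extendable24.
rewrite -(subnK (leq_trans (isT : 8 <= 26) n26)); apply: has_extendable8; apply: IH; lia.
Qed.

Theorem theorem6 (n : nat) :
  (exists G : sgraph, [/\ snark G, platypus G & graph_order G = n]) <->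
  (n = 10 \/ (~~ odd n /\ 18 <= n)).
Proof.
split=> [[G [[[G3 cubG] [connG _] _ g5] [_ nhamG _] <-]]|n_ok].
  have G_even := order_even cubG; rewrite /graph_order in G3 *.
  have [->|/eqP G10] := eqVneq #|G| 10; [by left | right; split=> //].
  (* The even orders from 4 to 16 other than 10 are exactly those searched. *)
  rewrite leqNgt; apply/negP=> G18; apply: (small_hamiltonian cubG connG g5) nhamG.
  by rewrite !inE; move: #|G| G3 G_even G10 G18; do 18?[case=> //].
suff [G [a [b [c [d [ext <-]]]]]] : has_extendable n.
  by exists G; split=> //; [exact: extendable_snark ext | exact: extendable_platypus ext].
case: n_ok => [->|[n_even n18]]; [exact: has_extendable10 | exact: even_extendable].
Qed.
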